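(* Let $x_0\in X_s$ with $\|x_0\|\le X$, let $\bar\gamma>\underline\gamma$ satisfy $\|w^\star(\bar\gamma)\|=1$ for this $x_0$, and let $u^\infty_t=-K^\infty x_t$, with $K^\infty=K^\infty(\bar\gamma)$, be the corresponding infinite-horizon $\mathcal H_\infty$ controller. Let $w\in\bar{\mathcal L}_2$ (i.e. $\|w\|\le 1$) be any disturbance realization and let $\Delta w:=w-w^\star$, $w^\star:=w^\star(\bar\gamma)$, be the disturbance-reality gap. Then the infinite-horizon dynamic regret of the $\mathcal H_\infty$ controller satisfies $$\mathcal R(\mathcal H_\infty,w)\;\le\;k_1\|\Delta w\|+k_2\|\Delta w\|^2,$$ where $$k_2=2\|\bar P\|+\|H\|\,\|P\|^2\frac{c^2}{(1-\lambda)^2},$$ $$k_1=4\|\bar P\|+4c\|\bar P\|(2+X)\Big(\frac{\bar\lambda}{1-\bar\lambda}\Big)+2\|H\|\,\|P\|^2\frac{c^2}{(1-\lambda)^2}.$$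
   Context: System and cost. $x_{t+1}=Ax_t+Bu_t+w_t$, with $x_t,w_t\in\mathbb R^n$, $u_t\in\mathbb R^m$, $A\in\mathbb R^{n\times n}$, $B\in\mathbb R^{n\times m}$ known, $x_0\in\mathbb R^n$ with $\|x_0\|\le X$ for a given $X>0$. Cost matrices $Q,Q_T\succeq0$ in $\mathbb R^{n\times n}$ (where $Q_T$ is the terminal weight) and $R\succ0$ in $\mathbb R^{m\times m}$; $(A,Q)$ is detectable and $(A,B)$ is stabilizable. $J^T(u,w;x_0)=x_T^\top Q_Tx_T+\sum_{t=0}^{T-1}(x_t^\top Qx_t+u_t^\top Ru_t)$ and $J(u,w;x_0)=\lim_{T\to\infty}J^T(u,w;x_0)$. For sequences $w=(w_t)_{t\ge0}$, $\|w\|=(\sum_t\|w_t\|^2)^{1/2}$; $\bar{\mathcal L}_2$ is the set of sequences with $\|w\|\le1$. For matrices $\|\cdot\|$ is the spectral norm and $\rho(\cdot)$ the spectral radius. $\mathcal H_\infty$ controller (infinite horizon). The disturbance attenuation problem is to attain $\inf_\mu\sup_{\|w\|=1}J(\mu,w;x_0)^{1/2}$ over policies $\mu$ with access to current and past states. For $\gamma>0$ let $M(\gamma)$ be the minimal non-negative definite solution (when it exists) of $$M=Q+A^\top M\Lambda^{-1}A,\qquad \Lambda=I+(BR^{-1}B^\top-\gamma^{-2}I)M,$$ and $\Lambda(\gamma)$ the corresponding $\Lambda$. Let $\underline\gamma$ be the lowest value (infimum) of $\gamma>0$ such that $M(\gamma)$ exists and $\gamma^2I-M(\gamma)\succ0$;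 for every $\gamma>\underline\gamma$, $M(\gamma)$ exists, $\gamma^2I-M(\gamma)\succ0$ and $\Lambda(\gamma)$ is nonsingular. For $\gamma>\underline\gamma$ and initial state $x_0$ define the open-loop worst-case disturbance $$w^\star_t(\gamma)=\gamma^{-2}M(\gamma)\Lambda^{-1}(\gamma)A\,x_t^\infty,\qquad x^\infty_{t+1}=\Lambda^{-1}(\gamma)Ax^\infty_t,\quad x^\infty_0=x_0,\quad t\ge0.$$ The set of admissible initial states is $X_s=\bigcup_{\gamma>\underline\gamma}\{x_0\in\mathbb R^n:\|w^\star(\gamma)\|=1\}$. For $x_0\in X_s$, choose $\bar\gamma>\underline\gamma$ with $\|w^\star(\bar\gamma)\|=1$; the $\mathcal H_\infty$ controller is $u^\infty_t=-K^\infty x_t$ with $K^\infty=R^{-1}B^\top M(\bar\gamma)\Lambda^{-1}(\bar\gamma)A$. Put $F^\infty=A-BK^\infty$; one has $\rho(F^\infty)<1$. Optimal offline controller. Let $P$ be the stabilizing solution of the discrete algebraic Riccati equation $P=Q+A^\top PA-A^\top PB(R+B^\top PB)^{-1}B^\top PA$, $K=(R+B^\top PB)^{-1}B^\top PA$, $F=A-BK$ (so $\rho(F)<1$). The optimal offline input $u^\star$ minimizes $J(u,w;x_0)$ with full knowledge of $w$ and is given by $u^\star_t=-Kx_t-(R+B^\top PB)^{-1}B^\top\sum_{i=0}^\infty(F^\top)^iPw_{t+i}$. Regret. $\mathcal R(\mathcal H_\infty,w)=J(u^\infty,w;x_0)-J(u^\star,w;x_0)$, both evaluated along the system driven by the same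 $w$ from the same $x_0$. Constants. $P^\infty$ is the unique solution of $P^\infty=F^{\infty\top}P^\infty F^\infty+Q+K^{\infty\top}RK^\infty$; $\|\bar P\|:=\max\{\|P^\infty\|,\|P\|\}$; $H:=B(R+B^\top PB)^{-1}B^\top$; $\lambda:=\frac{1+\rho(F)}2$, $\lambda^\infty:=\frac{1+\rho(F^\infty)}2$, $\bar\lambda:=\max\{\lambda,\lambda^\infty\}$; $c>1$ is a constant such that $\|F^i\|\le c\lambda^i$ and $\|(F^\infty)^i\|\le c(\lambda^\infty)^i$ for all $i\ge1$ (such $c$ exists by Gelfand's formula). *)

(* Defs.v *)
From HB Require Import structures.
From mathcomp Require Import all_boot all_order all_algebra.
From mathcomp Require Import complex.
From mathcomp Require Import all_classical all_reals all_analysis.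
Set Implicit Arguments.
Unset Strict Implicit.
Unset Printing Implicit Defensive.
Import Order.TTheory GRing.Theory Num.Theory.
Import numFieldNormedType.Exports.
Local Open Scope classical_set_scope.
Local Open Scope ring_scope.

(* The library norm on matrices is the max norm of the entries; the Euclidean
   and spectral norms are therefore defined here. *)
Definition enorm (R : realType) (n : nat) (x : 'cV[R]_n) : R :=
  Num.sqrt (\sum_i x i 0 ^+ 2).

Definition specnorm (R : realType) (m n : nat) (A : 'M[R]_(m, n)) : R :=
  sup [set enorm (A *m x) | x in [set x : 'cV[R]_n | enorm x <= 1]].

(* Complex eigenvalues of a real matrix. [eigenvalue] uses row eigenvectors,
   which does not change the spectrum. The radius is 0 when n = 0. *)
Definition spectral_radius (R : realType) (n : nat) (A : 'M[R]_n) : R :=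
  sup [set ComplexField.Normc.normc z |
         z in [set z : R[i] | eigenvalue (map_mx (real_complex R) A) z]].

Definition qform (R : realType) (n : nat) (M : 'M[R]_n) (x : 'cV[R]_n) : R :=
  (x^T *m M *m x) 0 0.

Definition psdmx (R : realType) (n : nat) (M : 'M[R]_n) : Prop :=
  M^T = M /\ forall x : 'cV[R]_n, 0 <= qform M x.

Definition pdmx (R : realType) (n : nat) (M : 'M[R]_n) : Prop :=
  M^T = M /\ forall x : 'cV[R]_n, x != 0 -> 0 < qform M x.

Definition stabilizable (R : realType) (n m : nat)
    (A : 'M[R]_n) (B : 'M[R]_(n, m)) : Prop :=
  exists K : 'M[R]_(m, n), spectral_radius (A - B *m K) < 1.

Definition detectable (R : realType) (n p : nat)
    (A : 'M[R]_n) (C : 'M[R]_(p, n)) : Prop :=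
  exists L : 'M[R]_(n, p), spectral_radius (A - L *m C) < 1.

(* Norm of a sequence of vectors; it is +oo when the sequence is not square
   summable. *)
Definition seqnorm (R : realType) (n : nat) (w : nat -> 'cV[R]_n) : \bar R :=
  sqrte (\sum_(0 <= t <oo) (enorm (w t) ^+ 2)%:E)%E.

Fixpoint traj (R : realType) (n m : nat) (A : 'M[R]_n) (B : 'M[R]_(n, m))
    (u : nat -> 'cV[R]_m) (w : nat -> 'cV[R]_n) (x0 : 'cV[R]_n) (t : nat) :
    'cV[R]_n :=
  if t is s.+1 then A *m traj A B u w x0 s + B *m u s + w s else x0.

Fixpoint fb_traj (R : realType) (n m : nat) (A : 'M[R]_n) (B : 'M[R]_(n, m))
    (K : 'M[R]_(m, n)) (w : nat -> 'cV[R]_n) (x0 : 'cV[R]_n) (t : nat) :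
    'cV[R]_n :=
  if t is s.+1 then
    let x := fb_traj A B K w x0 s in A *m x + B *m (- (K *m x)) + w s
  else x0.

Definition fb_input (R : realType) (n m : nat) (A : 'M[R]_n)
    (B : 'M[R]_(n, m)) (K : 'M[R]_(m, n)) (w : nat -> 'cV[R]_n)
    (x0 : 'cV[R]_n) (t : nat) : 'cV[R]_m :=
  - (K *m fb_traj A B K w x0 t).

Definition costT (R : realType) (n m : nat) (A : 'M[R]_n) (B : 'M[R]_(n, m))
    (Q QT : 'M[R]_n) (Rc : 'M[R]_m) (u : nat -> 'cV[R]_m)
    (w : nat -> 'cV[R]_n) (x0 : 'cV[R]_n) (T : nat) : R :=
  qform QT (traj A B u w x0 T)
  + \sum_(0 <= t < T) (qform Q (traj A B u w x0 t) + qform Rc (u t)).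

(* Extended-real limit. Under detectability of (A, Q) and for square-summable
   w it exists for every input: either the accumulated stage cost diverges, or
   it converges, the state tends to 0 and the terminal term vanishes. *)
Definition cost (R : realType) (n m : nat) (A : 'M[R]_n) (B : 'M[R]_(n, m))
    (Q QT : 'M[R]_n) (Rc : 'M[R]_m) (u : nat -> 'cV[R]_m)
    (w : nat -> 'cV[R]_n) (x0 : 'cV[R]_n) : \bar R :=
  limn (fun T => (costT A B Q QT Rc u w x0 T)%:E).

(* The input sequence u may depend on the whole realization w. *)
Definition offline_optimal (R : realType) (n m : nat) (A : 'M[R]_n)
    (B : 'M[R]_(n, m)) (Q QT : 'M[R]_n) (Rc : 'M[R]_m)
    (w : nat -> 'cV[R]_n) (x0 : 'cV[R]_n) (u : nat -> 'cV[R]_m) : Prop :=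
  forall v : nat -> 'cV[R]_m,
    (cost A B Q QT Rc u w x0 <= cost A B Q QT Rc v w x0)%E.

(* Stabilizing solution of the discrete algebraic Riccati equation. *)
Definition dare_gain (R : realType) (n m : nat) (A : 'M[R]_n)
    (B : 'M[R]_(n, m)) (Rc : 'M[R]_m) (P : 'M[R]_n) : 'M[R]_(m, n) :=
  invmx (Rc + B^T *m P *m B) *m B^T *m P *m A.

Definition dare_stabilizing (R : realType) (n m : nat) (A : 'M[R]_n)
    (B : 'M[R]_(n, m)) (Q : 'M[R]_n) (Rc : 'M[R]_m) (P : 'M[R]_n) : Prop :=
  [/\ P^T = P,
      Rc + B^T *m P *m B \in unitmx,
      P = Q + A^T *m P *m A
          - A^T *m P *m B *m invmx (Rc + B^T *m P *m B) *m B^T *m P *m A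
    & spectral_radius (A - B *m dare_gain A B Rc P) < 1].

Definition hinf_Lambda (R : realType) (n m : nat) (B : 'M[R]_(n, m))
    (Rc : 'M[R]_m) (g : R) (M : 'M[R]_n) : 'M[R]_n :=
  1%:M + (B *m invmx Rc *m B^T - (g ^- 2)%:M) *m M.

(* [invmx] is total, so the equation requires invertibility explicitly. *)
Definition hinf_riccati (R : realType) (n m : nat) (A : 'M[R]_n)
    (B : 'M[R]_(n, m)) (Q : 'M[R]_n) (Rc : 'M[R]_m) (g : R) (M : 'M[R]_n) :
    Prop :=
  [/\ psdmx M,
      hinf_Lambda B Rc g M \in unitmx
    & M = Q + A^T *m M *m invmx (hinf_Lambda B Rc g M) *m A].

(* M is M(g): the least element, in the Loewner order, of the set of
   non-negative definite solutions. *)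
Definition hinf_minimal (R : realType) (n m : nat) (A : 'M[R]_n)
    (B : 'M[R]_(n, m)) (Q : 'M[R]_n) (Rc : 'M[R]_m) (g : R) (M : 'M[R]_n) :
    Prop :=
  hinf_riccati A B Q Rc g M /\
  forall N : 'M[R]_n, hinf_riccati A B Q Rc g N -> psdmx (N - M).

(* Extended-real infimum, so that it is +oo, not 0, if no level is feasible. *)
Definition gamma_low (R : realType) (n m : nat) (A : 'M[R]_n)
    (B : 'M[R]_(n, m)) (Q : 'M[R]_n) (Rc : 'M[R]_m) : \bar R :=
  ereal_inf [set g%:E | g in [set g : R | 0 < g /\
    exists M : 'M[R]_n,
      hinf_minimal A B Q Rc g M /\ pdmx ((g ^+ 2)%:M - M)]].

Fixpoint wc_state (R : realType) (n m : nat) (A : 'M[R]_n)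
    (B : 'M[R]_(n, m)) (Rc : 'M[R]_m) (g : R) (M : 'M[R]_n)
    (x0 : 'cV[R]_n) (t : nat) : 'cV[R]_n :=
  if t is s.+1 then
    invmx (hinf_Lambda B Rc g M) *m A *m wc_state A B Rc g M x0 s
  else x0.

(* The open-loop worst-case disturbance. *)
Definition wc_dist (R : realType) (n m : nat) (A : 'M[R]_n)
    (B : 'M[R]_(n, m)) (Rc : 'M[R]_m) (g : R) (M : 'M[R]_n)
    (x0 : 'cV[R]_n) (t : nat) : 'cV[R]_n :=
  g ^- 2 *: (M *m invmx (hinf_Lambda B Rc g M) *m A
             *m wc_state A B Rc g M x0 t).

(* The set X_s. *)
Definition admissible_init (R : realType) (n m : nat) (A : 'M[R]_n)
    (B : 'M[R]_(n, m)) (Q : 'M[R]_n) (Rc : 'M[R]_m) : set 'cV[R]_n :=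
  [set x0 | exists (g : R) (M : 'M[R]_n),
     [/\ (gamma_low A B Q Rc < g%:E)%E,
         hinf_minimal A B Q Rc g M
       & seqnorm (wc_dist A B Rc g M x0) = 1%E]].

Definition hinf_gain (R : realType) (n m : nat) (A : 'M[R]_n)
    (B : 'M[R]_(n, m)) (Rc : 'M[R]_m) (g : R) (M : 'M[R]_n) :
    'M[R]_(m, n) :=
  invmx Rc *m B^T *m M *m invmx (hinf_Lambda B Rc g M) *m A.

Definition regret (R : realType) (n m : nat) (A : 'M[R]_n)
    (B : 'M[R]_(n, m)) (Q QT : 'M[R]_n) (Rc : 'M[R]_m)
    (u ustar : nat -> 'cV[R]_m) (w : nat -> 'cV[R]_n) (x0 : 'cV[R]_n) :
    \bar R :=
  (cost A B Q QT Rc u w x0 - cost A B Q QT Rc ustar w x0)%E.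

(* Main.v *)
Require Import Defs.
From HB Require Import structures.
From mathcomp Require Import all_boot all_order all_algebra.
From mathcomp Require Import complex.
From mathcomp Require Import all_classical all_reals all_analysis.
From mathcomp Require Import ring lra.
Set Implicit Arguments.
Unset Strict Implicit.
Unset Printing Implicit Defensive.
Import Order.TTheory GRing.Theory Num.Theory.
Import numFieldNormedType.Exports.
Local Open Scope classical_set_scope.
Local Open Scope ring_scope.

(* Completing the square with the Riccati solution [P] writes the cost of any
   input as a quadratic functional of [w] plus a nonnegative term; the costs of
   the H-infinity loop telescope in the same way through [Pinf].  Against the
   worst case [w*], the H-infinity input satisfies the first-order conditions of
   the offline problem, with costate [M x], so its regret vanishes there up to
   terminal terms.  The regret at [w] is therefore bounded by the variation
   between [w*] and [w] of two quadratic functionals, which Young's inequality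
   for geometric kernels controls linearly in [|w - w*|].  Only the [k1] part of
   the bound is needed.

   Stability of the H-infinity loop follows from [gbar^2 - M > 0] and
   detectability; [gbar^2 - M > 0] holds because value iteration at level [gbar]
   converges to a solution below any feasible one at a smaller level. *)

(** * Euclidean and spectral norms *)

(** The H-infinity input is a best response to [w*] because the game's term [- gbar^2 |w|^2] does
    not depend on the input: with the disturbance frozen, a saddle point is a minimiser in [u]. So
    only the change of the two functionals between [w*] and [w] has to be paid.

    The obstacle is that the offline optimum depends on the whole future of [w]. Comparisons are
    therefore made at a finite horizon [T], with the costate cut off to vanish at [T]. Along [w*]
    the cut-off costate misses the exact one by a term propagated back from time [T], and this term
    and all terminal terms tend to 0 by square summability. The finite-horizon inequality compares
    with an arbitrary input; optimality of [ustar] enters through the finiteness of its cost.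

    Linearity in [|w - w*|] comes from [a b - a' b' = (a - a') b + a' (b - b')], with the unvaried
    factor bounded through [|w| <= 1], [|w*| <= 1] and [X]. Each functional contributes
    [2 |P| + 2 c |P| (2 + X) lam / (1 - lam)] with its own matrix and rate, whence the factors 4 in
    [k1]. *)

Definition dot (R : realType) (n : nat) (x y : 'cV[R]_n) : R := (x^T *m y) 0 0.

Section Dot.
Variables (R : realType) (n : nat).
Implicit Types (x y z : 'cV[R]_n).

Lemma dotE x y : dot x y = \sum_i x i 0 * y i 0.
Proof. by rewrite /dot mxE; apply: eq_bigr => i _; rewrite mxE. Qed.

Lemma dotC x y : dot x y = dot y x.
Proof. by rewrite !dotE; apply: eq_bigr => i _; rewrite mulrC. Qed.

Lemma dotDl x y z : dot (x + y) z = dot x z + dot y z.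
Proof. by rewrite /dot linearD mulmxDl mxE. Qed.

Lemma dotDr x y z : dot x (y + z) = dot x y + dot x z.
Proof. by rewrite /dot mulmxDr mxE. Qed.

Lemma dotNl x y : dot (- x) y = - dot x y.
Proof. by rewrite /dot linearN mulNmx mxE. Qed.

Lemma dotNr x y : dot x (- y) = - dot x y.
Proof. by rewrite /dot mulmxN mxE. Qed.

Lemma dotZl a x y : dot (a *: x) y = a * dot x y.
Proof. by rewrite /dot linearZ -scalemxAl mxE. Qed.

Lemma dotZr a x y : dot x (a *: y) = a * dot x y.
Proof. by rewrite /dot -scalemxAr mxE. Qed.

Lemma dot0l y : dot 0 y = 0.
Proof. by rewrite /dot trmx0 mul0mx mxE. Qed.

Lemma dot0r x : dot x 0 = 0.
Proof. by rewrite /dot mulmx0 mxE. Qed.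

Definition dotlin := (dotDl, dotDr, dotNl, dotNr, dotZl, dotZr, dot0l, dot0r).

Lemma dotxx_ge0 x : 0 <= dot x x.
Proof. by rewrite dotE; apply: sumr_ge0 => i _; rewrite -expr2 sqr_ge0. Qed.

Lemma dotxx_eq0 x : dot x x = 0 -> x = 0.
Proof.
rewrite dotE => /eqP; rewrite psumr_eq0; last by move=> i _; rewrite -expr2 sqr_ge0.
move=> /allP h; apply/matrixP => i j; rewrite (ord1 j) mxE.
by have := h i (mem_index_enum _); rewrite /= mulf_eq0 orbb => /eqP.
Qed.

Lemma enorm_ge0 x : 0 <= enorm x.
Proof. exact: sqrtr_ge0. Qed.

Lemma enorm_sqr x : enorm x ^+ 2 = dot x x.
Proof.
by rewrite sqr_sqrtr ?dotE; [apply: eq_bigr => i _; rewrite expr2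
  | apply: sumr_ge0 => i _; exact: sqr_ge0].
Qed.

Lemma enorm_eq0 x : enorm x = 0 -> x = 0.
Proof. by move=> h; apply: dotxx_eq0; rewrite -enorm_sqr h expr0n. Qed.

Lemma enorm0 : enorm (0 : 'cV[R]_n) = 0.
Proof. by apply/eqP; rewrite -sqrf_eq0 enorm_sqr dot0l. Qed.

Lemma enormZ a x : enorm (a *: x) = `|a| * enorm x.
Proof.
apply/eqP; rewrite -(@eqrXn2 _ 2) ?mulr_ge0 ?enorm_ge0//.
by rewrite exprMn !enorm_sqr !dotlin real_normK ?num_real// mulrA expr2.
Qed.

Lemma enormN x : enorm (- x) = enorm x.
Proof. by rewrite -scaleN1r enormZ normrN1 mul1r. Qed.

Lemma dot_le_enorm x y : dot x y <= enorm x * enorm y.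
Proof.
have [x0|xn0] := eqVneq (enorm x) 0.
  by rewrite (enorm_eq0 x0) dot0l enorm0 mul0r.
have [y0|yn0] := eqVneq (enorm y) 0.
  by rewrite (enorm_eq0 y0) dot0r enorm0 mulr0.
have xy0 : 0 < enorm x * enorm y by rewrite mulr_gt0// lt_def enorm_ge0 ?xn0 ?yn0.
(* With [a], [b] the norms and [d] the inner product, this square equals [2 a b (a b - d)]. *)
have := dotxx_ge0 (enorm y *: x - enorm x *: y).
rewrite !dotlin (dotC y x) -!enorm_sqr.
move: (enorm x) (enorm y) (dot x y) xy0 => a b d ab0 h.
rewrite -(ler_pM2l ab0); nra.
Qed.

Lemma normr_dot_le x y : `|dot x y| <= enorm x * enorm y.
Proof.
by rewrite ler_norml dot_le_enorm andbT lerNl -dotNl (le_trans (dot_le_enorm _ _))// enormN.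
Qed.

Lemma enormD x y : enorm (x + y) <= enorm x + enorm y.
Proof.
rewrite -(@ler_pXn2r _ 2) ?nnegrE ?addr_ge0 ?enorm_ge0//.
rewrite enorm_sqr !dotlin (dotC y x) -!enorm_sqr.
have := dot_le_enorm x y; lra.
Qed.

Lemma enorm_sum I (r : seq I) (Pr : pred I) (F : I -> 'cV[R]_n) :
  enorm (\sum_(i <- r | Pr i) F i) <= \sum_(i <- r | Pr i) enorm (F i).
Proof.
elim/big_ind2 : _ => [|x a y b xa yb|//]; first by rewrite enorm0.
by rewrite (le_trans (enormD _ _))// lerD.
Qed.

End Dot.

Section Specnorm.
Variables (R : realType) (m n : nat).
Implicit Types (A : 'M[R]_(m, n)).

Lemma dot_mulmxl A (x : 'cV_n) (y : 'cV_m) : dot (A *m x) y = dot x (A^T *m y).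
Proof. by rewrite /dot trmx_mul mulmxA. Qed.

(** The supremum in [specnorm] is informative only on a bounded set; the sum of the row norms is a
    crude but sufficient bound. *)
Lemma enorm_mulmx_bounded A :
  exists C : R, forall x : 'cV[R]_n, enorm (A *m x) <= C * enorm x.
Proof.
exists (\sum_i enorm (row i A)^T) => x.
have -> : A *m x = \sum_i (dot (row i A)^T x) *: delta_mx i 0.
  apply/matrixP => i j; rewrite (ord1 j) summxE (bigD1 i)//= [X in _ + X]big1.
    rewrite addr0 [RHS]mxE dotE [delta_mx _ _ _ _]mxE !eqxx mulr1 mxE.
    by apply: eq_bigr => k _; rewrite !mxE.
  by move=> k ki; rewrite !mxE [i == k]eq_sym (negbTE ki) mulr0.
rewrite (le_trans (enorm_sum _ _ _))// mulr_suml ler_sum// => i _.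
rewrite enormZ; have -> : enorm (delta_mx i 0 : 'cV[R]_m) = 1.
  apply/eqP; rewrite -(@eqrXn2 _ 2) ?enorm_ge0// enorm_sqr dotE expr1n.
  rewrite (bigD1 i)//= big1 ?mxE ?eqxx ?mulr1 ?addr0// => k ki.
  by rewrite mxE (negbTE ki) mul0r.
by rewrite mulr1 normr_dot_le.
Qed.

Let unit_image A := [set enorm (A *m x) | x in [set x : 'cV[R]_n | enorm x <= 1]].

Lemma has_ubound_unit_image A : has_ubound (unit_image A).
Proof.
have [C hC] := enorm_mulmx_bounded A; exists `|C| => _ [x /= x1 <-].
rewrite (le_trans (hC x))// (le_trans (ler_norm _))// normrM.
by rewrite ler_piMr// ger0_norm// enorm_ge0.
Qed.

Lemma specnorm_ge0 A : 0 <= specnorm A.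
Proof.
apply: (ub_le_sup (has_ubound_unit_image A)).
by exists 0; rewrite /= ?mulmx0 enorm0.
Qed.

Lemma specnorm_mulmx A x : enorm (A *m x) <= specnorm A * enorm x.
Proof.
have [x0|xn0] := eqVneq (enorm x) 0.
  by rewrite (enorm_eq0 x0) mulmx0 !enorm0 mulr0.
have xp : 0 < enorm x by rewrite lt_def xn0 enorm_ge0.
have : enorm (A *m ((enorm x)^-1 *: x)) <= specnorm A.
  apply: (ub_le_sup (has_ubound_unit_image A)); exists ((enorm x)^-1 *: x) => //=.
  by rewrite enormZ ger0_norm ?invr_ge0 ?enorm_ge0// mulVf.
rewrite -scalemxAr enormZ ger0_norm ?invr_ge0 ?enorm_ge0//.
by rewrite mulrC ler_pdivrMr.
Qed.

Lemma normr_dot_mulmx A y x :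
  `|dot y (A *m x)| <= specnorm A * (enorm y * enorm x).
Proof.
rewrite (le_trans (normr_dot_le _ _))// mulrCA ler_wpM2l ?enorm_ge0//.
exact: specnorm_mulmx.
Qed.

(** Since [|A^T y|^2] is the inner product of [y] with [A (A^T y)], one factor [|A^T y|] can be
    divided out. *)
Lemma specnorm_trmulmx A y : enorm (A^T *m y) <= specnorm A * enorm y.
Proof.
have [x0|xn0] := eqVneq (enorm (A^T *m y)) 0.
  by rewrite x0 mulr_ge0 ?enorm_ge0// specnorm_ge0.
have xp : 0 < enorm (A^T *m y) by rewrite lt_def xn0 enorm_ge0.
rewrite -(ler_pM2r xp) -expr2 enorm_sqr -dot_mulmxl dotC -mulrA.
exact: le_trans (ler_norm _) (normr_dot_mulmx _ _ _).
Qed.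

End Specnorm.

(** The truncated norm is the Euclidean norm of a column, so that the triangle and Cauchy-Schwarz
    inequalities are inherited from [enorm]. *)
Definition l2 (R : realType) (T : nat) (a : nat -> R) : R :=
  enorm (\col_(i < T) a i).

Section L2.
Variables (R : realType).
Implicit Types (a b h k : nat -> R) (T : nat).

Lemma l2_ge0 T a : 0 <= l2 T a. Proof. exact: enorm_ge0. Qed.

Lemma l2_sqr T a : l2 T a ^+ 2 = \sum_(0 <= t < T) a t ^+ 2.
Proof.
by rewrite enorm_sqr dotE big_mkord; apply: eq_bigr => i _; rewrite mxE expr2.
Qed.

Lemma l2D T a b : l2 T (fun t => a t + b t) <= l2 T a + l2 T b.
Proof.
rewrite (le_trans _ (enormD _ _))// le_eqVlt; apply/orP; left; apply/eqP.
by congr enorm; apply/matrixP => i j; rewrite !mxE.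
Qed.

Lemma l2Z T c a : l2 T (fun t => c * a t) = `|c| * l2 T a.
Proof.
by rewrite -enormZ; congr enorm; apply/matrixP => i j; rewrite !mxE.
Qed.

Lemma l2_le T a b : (forall t, (t < T)%N -> 0 <= a t <= b t) -> l2 T a <= l2 T b.
Proof.
move=> ab; rewrite -(@ler_pXn2r _ 2) ?nnegrE ?l2_ge0// !l2_sqr.
apply: ler_sum_nat => t /andP[_ /ab /andP[a0 ab']].
by rewrite lerXn2r// ?nnegrE// (le_trans a0).
Qed.

Lemma sum_mul_le_l2 T a b : \sum_(0 <= t < T) a t * b t <= l2 T a * l2 T b.
Proof.
rewrite (le_trans _ (dot_le_enorm _ _))// dotE big_mkord le_eqVlt; apply/orP; left.
by apply/eqP/eq_bigr => i _; rewrite !mxE.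
Qed.

Lemma le_l2 T a t : (t < T)%N -> a t <= l2 T a.
Proof.
move=> tT; rewrite (le_trans (ler_norm _))//.
rewrite -(@ler_pXn2r _ 2) ?nnegrE ?l2_ge0// l2_sqr real_normK ?num_real//.
rewrite big_mkord (bigD1 (Ordinal tT))//= lerDl.
by apply: sumr_ge0 => i _; exact: sqr_ge0.
Qed.

Lemma l2_leS T a : l2 T a <= l2 T.+1 a.
Proof.
rewrite -(@ler_pXn2r _ 2) ?nnegrE ?l2_ge0// !l2_sqr big_nat_recr//= lerDl.
exact: sqr_ge0.
Qed.

(** Young's inequality for a geometric kernel, without convolutions: after [h 0] is split off, the
    shifted sequence has norm at most [lam * (l2 T h + l2 T a)], and as [lam < 1] the part in [h] is
    absorbed into the left-hand side. *)
Lemma l2_forward_filter T h a (lam x : R) : 0 <= lam < 1 -> 0 <= x ->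
  (forall t, 0 <= h t) -> (forall t, 0 <= a t) ->
  h 0%N <= lam * x -> (forall t, h t.+1 <= lam * (h t + a t)) ->
  l2 T h <= lam / (1 - lam) * (x + l2 T a).
Proof.
move=> /andP[lam0 lam1] x0 hp ap h0 hS.
have l1 : 0 < 1 - lam by lra.
have step : l2 T.+1 h <= lam * x + lam * (l2 T h + l2 T a).
  have hx : 0 <= lam * x by rewrite mulr_ge0.
  have hy : 0 <= lam * (l2 T h + l2 T a) by rewrite mulr_ge0// addr_ge0// l2_ge0.
  rewrite -(@ler_pXn2r _ 2) ?nnegrE ?l2_ge0 ?addr_ge0//.
  rewrite l2_sqr big_nat_recl//=.
  have : \sum_(0 <= t < T) h t.+1 ^+ 2 <= (lam * (l2 T h + l2 T a)) ^+ 2.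
    rewrite -l2_sqr lerXn2r ?nnegrE ?l2_ge0//.
    apply: (@le_trans _ _ (l2 T (fun t => lam * (h t + a t)))).
      by apply: l2_le => t _; rewrite hp hS.
    by rewrite l2Z ger0_norm// ler_wpM2l// l2D.
  have : h 0%N ^+ 2 <= (lam * x) ^+ 2 by rewrite lerXn2r ?nnegrE.
  rewrite sqrrD; move: (mulr_ge0 hx hy) => hh ? ?; lra.
have := le_trans (l2_leS T h) step.
rewrite mulrAC ler_pdivlMr//; lra.
Qed.

(** The same absorption backwards in time: [k T = 0] ensures that shifting [k] does not increase its
    truncated norm. *)
Lemma l2_backward_filter T k a (lam : R) : 0 <= lam < 1 ->
  (forall t, 0 <= k t) -> k T = 0 ->
  (forall t, (t < T)%N -> k t <= a t + lam * k t.+1) ->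
  l2 T k <= l2 T a / (1 - lam).
Proof.
move=> /andP[lam0 lam1] kp kT kS.
have l1 : 0 < 1 - lam by lra.
have sh : l2 T (fun t => k t.+1) <= l2 T k.
  rewrite -(@ler_pXn2r _ 2) ?nnegrE ?l2_ge0// !l2_sqr.
  have := big_nat_recl T 0 (fun t => k t ^+ 2) (leq0n T) (op := +%R) (idx := 0).
  rewrite big_nat_recr//= kT expr0n/= addr0 => ->.
  by rewrite lerDr sqr_ge0.
have : l2 T k <= l2 T a + lam * l2 T (fun t => k t.+1).
  apply: (@le_trans _ _ (l2 T (fun t => a t + lam * k t.+1))).
    by apply: l2_le => t tT; rewrite kp kS.
  by rewrite (le_trans (l2D _ _ _))// l2Z ger0_norm.
have := ler_wpM2l lam0 sh.
rewrite ler_pdivlMr//; lra.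
Qed.

End L2.

(** * Square-summable trajectories and the spectral radius *)

(** Square summability as a uniform bound on truncations, which keeps infinite series out of the
    estimates. *)
Definition l2_bounded (R : realType) (a : nat -> R) : Prop :=
  exists C : R, forall T, l2 T a <= C.

Section L2Bounded.
Variable R : realType.
Implicit Types a b : nat -> R.

Lemma l2_boundedD a b :
  l2_bounded a -> l2_bounded b -> l2_bounded (fun t => a t + b t).
Proof.
move=> [C hC] [D hD]; exists (C + D) => T.
by rewrite (le_trans (l2D _ _ _))// lerD.
Qed.

Lemma l2_bounded_le (c : R) a b : (forall t, 0 <= a t <= c * b t) ->
  l2_bounded b -> l2_bounded a.
Proof.
move=> h [C hC]; exists (`|c| * C) => T.
apply: (@le_trans _ _ (l2 T (fun t => c * b t))); first by apply: l2_le.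
by rewrite l2Z ler_wpM2l.
Qed.

Lemma l2_bounded_scale (c : R) a : l2_bounded a -> l2_bounded (fun t => c * a t).
Proof.
by move=> [C hC]; exists (`|c| * C) => T; rewrite l2Z ler_wpM2l.
Qed.

Lemma l2_bounded_sum a C : (forall T, \sum_(0 <= t < T) a t ^+ 2 <= C) ->
  l2_bounded a.
Proof.
move=> h; exists (Num.sqrt C) => T.
have C0 : 0 <= C by have := h 0%N; rewrite big_geq.
rewrite -(@ler_pXn2r _ 2) ?nnegrE ?l2_ge0 ?sqrtr_ge0// l2_sqr sqr_sqrtr//.
Qed.

Lemma l2_bounded_filter (r : R) a b : 0 <= r < 1 -> (forall t, 0 <= a t) ->
  (forall t, a t.+1 <= r * a t + b t) -> l2_bounded b -> l2_bounded a.
Proof.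
move=> /andP[r0 r1] ap aS [C hC].
have C0 : 0 <= C by rewrite (le_trans _ (hC 0%N))// l2_ge0.
exists ((a 0%N + C) / (1 - r)) => T.
have step : l2 T.+1 a <= a 0%N + (r * l2 T a + C).
  rewrite -(@ler_pXn2r _ 2) ?nnegrE ?l2_ge0 ?addr_ge0 ?mulr_ge0 ?l2_ge0//.
  rewrite l2_sqr big_nat_recl//=.
  have hS : l2 T (fun t => a t.+1) <= r * l2 T a + C.
    apply: (@le_trans _ _ (l2 T (fun t => r * a t + b t))).
      by apply: l2_le => t _; rewrite ap aS.
    by rewrite (le_trans (l2D _ _ _))// l2Z ger0_norm// lerD.
  have : l2 T (fun t => a t.+1) ^+ 2 <= (r * l2 T a + C) ^+ 2.
    by rewrite lerXn2r ?nnegrE ?l2_ge0 ?addr_ge0 ?mulr_ge0 ?l2_ge0.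
  rewrite l2_sqr (sqrrD (a 0%N)).
  have : 0 <= a 0%N * (r * l2 T a + C).
    by rewrite mulr_ge0// addr_ge0// mulr_ge0// l2_ge0.
  by move=> ? ?; lra.
have := le_trans (l2_leS T a) step.
by rewrite ler_pdivlMr; lra.
Qed.

Lemma l2_bounded_cvg0 a : l2_bounded a -> a @ \oo --> (0 : R).
Proof.
move=> [C hC].
have cv : cvgn (series (fun t => a t ^+ 2)).
  apply: nondecreasing_is_cvgn.
    apply/nondecreasing_seqP => k; rewrite /series/= big_nat_recr//= lerDl.
    exact: sqr_ge0.
  exists (C ^+ 2) => _ [k _ <-]; rewrite /series/= -l2_sqr.
  by rewrite lerXn2r ?nnegrE ?l2_ge0// (le_trans _ (hC 0%N)) ?l2_ge0.
have sq0 := cvg_series_cvg_0 cv.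
have : (Num.sqrt \o (fun t => a t ^+ 2)) @ \oo --> Num.sqrt (0 : R).
  by apply: continuous_cvg => //; exact: sqrt_continuous.
rewrite sqrtr0 => h; apply/norm_cvg0P.
by apply: cvg_trans h; apply: near_eq_cvg; near=> t; rewrite /= sqrtr_sqr.
Unshelve. all: by end_near. Qed.

End L2Bounded.

(** * Norms of complex vectors *)

Section ComplexNorm.
Variables (R : realType) (n : nat).
Notation normc := ComplexField.Normc.normc.
Implicit Types (v : 'cV[R[i]]_n).

Lemma normc_ge0 (z : R[i]) : 0 <= normc z.
Proof. by case: z => a b; exact: sqrtr_ge0. Qed.

Definition cnorm v : R := \sum_i normc (v i 0).

Lemma cnorm_ge0 v : 0 <= cnorm v.
Proof. by apply: sumr_ge0 => i _; exact: normc_ge0. Qed.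

Lemma cnormD v v' : cnorm (v + v') <= cnorm v + cnorm v'.
Proof.
rewrite -big_split/=; apply: ler_sum => i _; rewrite mxE.
exact: le_normcD.
Qed.

Lemma cnormZ z v : cnorm (z *: v) = normc z * cnorm v.
Proof.
by rewrite mulr_sumr; apply: eq_bigr => i _; rewrite mxE ComplexField.Normc.normcM.
Qed.

Lemma normc_sum I (r : seq I) (F : I -> R[i]) :
  normc (\sum_(i <- r) F i) <= \sum_(i <- r) normc (F i).
Proof.
elim/big_ind2 : _ => [|x a y b xa yb|//]; first by rewrite ComplexField.Normc.normc0.
by rewrite (le_trans (le_normcD _ _))// lerD.
Qed.

Lemma normc_coord v i : normc (v i 0) <= cnorm v.
Proof.
by rewrite /cnorm (bigD1 i)//= lerDl; apply: sumr_ge0 => j _; exact: normc_ge0.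
Qed.

Lemma cnorm_mulmx_bounded (M : 'M[R[i]]_n) :
  exists C : R, forall v, cnorm (M *m v) <= C * cnorm v.
Proof.
exists (\sum_i \sum_j normc (M i j)) => v.
rewrite mulr_suml; apply: ler_sum => i _; rewrite mxE.
rewrite (le_trans (normc_sum _ _))// mulr_suml; apply: ler_sum => j _.
by rewrite ComplexField.Normc.normcM ler_wpM2l ?normc_ge0 ?normc_coord.
Qed.

Lemma normc_real (x : R) : normc (real_complex R x) = `|x|.
Proof. by rewrite /= expr0n/= addr0 sqrtr_sqr. Qed.

Lemma abs_coord_le_enorm (x : 'cV[R]_n) i : `|x i 0| <= enorm x.
Proof.
rewrite -(@ler_pXn2r _ 2) ?nnegrE ?enorm_ge0// enorm_sqr dotE (bigD1 i)//=.
rewrite real_normK ?num_real// -expr2 lerDl.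
by apply: sumr_ge0 => j _; rewrite -expr2 sqr_ge0.
Qed.

Lemma cnorm_map_le (x : 'cV[R]_n) :
  cnorm (map_mx (real_complex R) x) <= n%:R * enorm x.
Proof.
rewrite /cnorm; apply: (@le_trans _ _ (\sum_(i < n) enorm x)).
  by apply: ler_sum => i _; rewrite mxE normc_real abs_coord_le_enorm.
by rewrite big_const_ord iter_addr_0 mulr_natl.
Qed.

Lemma enorm_le_cnorm_map (x : 'cV[R]_n) :
  enorm x <= cnorm (map_mx (real_complex R) x).
Proof.
have -> : x = \sum_i x i 0 *: delta_mx i 0.
  apply/matrixP => i j; rewrite (ord1 j) summxE (bigD1 i)//= [X in _ + X]big1.
    by rewrite !mxE !eqxx mulr1 addr0.
  by move=> k ki; rewrite !mxE [i == k]eq_sym (negbTE ki) mulr0.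
rewrite (le_trans (enorm_sum _ _ _))//; apply: ler_sum => i _.
rewrite enormZ mxE normc_real summxE (bigD1 i)//= [X in `|_ + X|]big1; last first.
  by move=> k ki; rewrite !mxE [i == k]eq_sym (negbTE ki) mulr0.
rewrite !mxE !eqxx mulr1 addr0 ler_piMr//.
rewrite -(@ler_pXn2r _ 2) ?nnegrE ?enorm_ge0// enorm_sqr dotE expr1n.
rewrite (bigD1 i)//= big1 ?mxE ?eqxx ?mulr1 ?addr0// => k ki.
by rewrite mxE (negbTE ki) mul0r.
Qed.

End ComplexNorm.

Section SpectralRadius.
Variable R : realType.
Notation normc := ComplexField.Normc.normc.
Local Notation toC := (map_mx (real_complex R)).

Lemma eigenvalue_seq n (A : 'M[R]_n) : exists s : seq R[i],
  char_poly (toC A) = \prod_(z <- s) ('X - z%:P) /\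
  forall z, eigenvalue (toC A) z = (z \in s).
Proof.
have [s hs] := closed_field_poly_normal (char_poly (toC A)).
rewrite (monicP (char_poly_monic _)) scale1r in hs.
by exists s; split=> // z; rewrite eigenvalue_root_char hs root_prod_XsubC.
Qed.

Lemma spectral_radius_ge0 n (A : 'M[R]_n) : 0 <= spectral_radius A.
Proof.
rewrite /spectral_radius; set S := [set _ | _ in _].
have [hS|/sup_out ->//] := pselect (has_sup S).
have [[_ [z zA _]] _] := hS; apply: le_trans (normc_ge0 z) _.
by apply: (sup_upper_bound hS); exists z.
Qed.

(** The spectrum is finite, so some [r] dominates all moduli and is below 1 as soon as each of them
    is: the strict inequality survives the supremum. An empty spectrum gives [sup set0 = 0]. *)
Lemma spectral_radius_lt1P n (A : 'M[R]_n) :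
  spectral_radius A < 1 <-> forall z, eigenvalue (toC A) z -> normc z < 1.
Proof.
have [s [_ hs]] := eigenvalue_seq A.
have [r rs r1] : exists2 r : R, (forall z, z \in s -> normc z <= r) &
    ((forall z, z \in s -> normc z < 1) -> r < 1).
  elim: s {hs} => [|z s [r rs r1]]; first by exists 0.
  exists (Num.max (normc z) r) => [y|h].
    by rewrite inE le_max => /orP[/eqP ->|/rs ->]; rewrite ?lexx ?orbT.
  rewrite gt_max h ?mem_head//= r1// => y ys.
  by apply: h; rewrite inE ys orbT.
split=> [A1 z zA|h].
  apply: le_lt_trans A1; apply: ub_le_sup; last by exists z.
  by exists r => _ [y /= yA <-]; apply: rs; rewrite -hs.
have [[z zA]|no] := pselect (exists z, eigenvalue (toC A) z); last first.
  rewrite /spectral_radius (_ : [set _ | _ in _] = set0) ?sup0//.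
  by rewrite -subset0 => y [z zA _]; apply: no; exists z.
apply: (@le_lt_trans _ _ r); last by apply: r1 => y; rewrite -hs; exact: h.
apply: ge_sup; first by exists (normc z), z.
by move=> _ [y /= yA <-]; apply: rs; rewrite -hs.
Qed.

(* Peeling the factors [A - z] off the characteristic polynomial one at a time
   leaves scalar recursions, so that no bound on the powers of [A] is needed. *)
Lemma l2_bounded_product n (A : 'M[R[i]]_n.+1) (s : seq R[i])
    (x b : nat -> 'cV[R[i]]_n.+1) :
  (forall z, z \in s -> normc z < 1) ->
  (forall t, x t.+1 = A *m x t + b t) ->
  l2_bounded (fun t => cnorm (b t)) ->
  l2_bounded (fun t => cnorm (horner_mx A (\prod_(z <- s) ('X - z%:P)) *m x t)) ->
  l2_bounded (fun t => cnorm (x t)).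
Proof.
move=> s1 xS hb; elim: s s1 => [_|z s IH s1].
  by rewrite big_nil rmorph1; under eq_fun do rewrite mul1mx.
rewrite big_cons; set p := \prod_(j <- s) _ => h.
apply: IH => [y ys|]; first by apply: s1; rewrite inE ys orbT.
have [C hC] := cnorm_mulmx_bounded (horner_mx A p).
apply: (@l2_bounded_filter _ (normc z) _
  (fun t => cnorm (horner_mx A (('X - z%:P) * p) *m x t) + C * cnorm (b t))).
- by rewrite normc_ge0 s1// mem_head.
- by move=> t; exact: cnorm_ge0.
- move=> t; rewrite xS mulmxDr.
  (* As [A p(A) = z p(A) + ((X - z) p)(A)], the sequence [p(A) x] obeys a scalar recursion of ratio
     [z], forced by the longer product, square summable by [h], and by [b]. *)
  have -> : horner_mx A p *m (A *m x t) =
      z *: (horner_mx A p *m x t) + horner_mx A (('X - z%:P) * p) *m x t.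
    rewrite mulmxA.
    have -> : horner_mx A p *m A = horner_mx A ('X * p).
      by rewrite mulrC rmorphM/= horner_mx_X.
    by rewrite mulrBl rmorphB/= mulmxBl mul_polyC linearZ/= -scalemxAl addrC subrK.
  rewrite (le_trans (cnormD _ _))// (le_trans (lerD (cnormD _ _) (lexx _)))//.
  by rewrite cnormZ addrA lerD.
- by apply: l2_boundedD => //; apply: l2_bounded_scale.
Qed.

(* Cayley-Hamilton turns [l2_bounded_product] into input-to-state stability. *)
Lemma spectral_radius_lt1_l2 n (A : 'M[R]_n) (x b : nat -> 'cV[R]_n) :
  spectral_radius A < 1 ->
  (forall t, x t.+1 = A *m x t + b t) ->
  l2_bounded (fun t => enorm (b t)) -> l2_bounded (fun t => enorm (x t)).
Proof.
case: n A x b => [|n] A x b A1 xS hb.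
  exists 0 => T; rewrite (_ : (fun t => enorm (x t)) = fun=> 0 * 0).
    by rewrite l2Z normr0 mul0r.
  by apply/funext => t; rewrite mul0r (_ : x t = 0) ?enorm0//; apply/matrixP => -[].
have [s [hs sA]] := eigenvalue_seq A.
apply: (@l2_bounded_le _ 1 _ (fun t => cnorm (toC (x t)))).
  by move=> t; rewrite mul1r enorm_ge0 enorm_le_cnorm_map.
apply: (@l2_bounded_product _ (toC A) s _ (fun t => toC (b t))).
- by move=> z; rewrite -sA; move/spectral_radius_lt1P : A1; exact.
- by move=> t; rewrite xS map_mxD map_mxM.
- apply: (@l2_bounded_le _ n.+1%:R) hb => t.
  by rewrite cnorm_ge0 cnorm_map_le.
- rewrite -hs Cayley_Hamilton; exists 0 => T.
  rewrite (_ : (fun t => _) = fun=> 0 * 0); first by rewrite l2Z normr0 mul0r.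
  apply/funext => t; rewrite mul0mx mul0r /cnorm big1// => i _.
  by rewrite mxE ComplexField.Normc.normc0.
Qed.

(** A left eigenvector [v] satisfies [v A^t e_j = z^t v_j]. If [|z| >= 1] and [v_j] is nonzero, this
    stays at least [|v_j|] in modulus, although [A^t e_j] tends to 0. *)
Lemma l2_powers_spectral_radius_lt1 n (A : 'M[R]_n) :
  (forall x : 'cV[R]_n, (fun t => enorm (A ^+ t *m x)) @ \oo --> (0 : R)) ->
  spectral_radius A < 1.
Proof.
move=> hA; apply/spectral_radius_lt1P => z /eigenvalueP[v vA v0].
have [j vj] : exists j, v 0 j != 0.
  apply: contrapT => h; move/eqP: v0; apply; apply/matrixP => i j.
  by rewrite (ord1 i) mxE; apply/eqP; apply: contrapT => /negP ?; apply: h; exists j.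
have pow t : v *m toC (A ^+ t) = z ^+ t *: v.
  elim: t => [|t IH]; first by rewrite !expr0 map_mx1 mulmx1 scale1r.
  by rewrite exprSr -mulmxE map_mxM mulmxA IH -scalemxAl vA scalerA exprSr.
pose e : 'cV[R]_n := delta_mx j 0.
have [C hC] : exists C : R, forall y : 'cV[R]_n, normc ((v *m toC y) 0 0) <= C * enorm y.
  exists (\sum_i normc (v 0 i)) => y; rewrite mxE (le_trans (normc_sum _ _))//.
  rewrite mulr_suml; apply: ler_sum => i _.
  rewrite ComplexField.Normc.normcM ler_wpM2l ?normc_ge0// mxE normc_real.
  exact: abs_coord_le_enorm.
rewrite ltNge; apply/negP => z1.
have : (fun t => C * enorm (A ^+ t *m e)) @ \oo --> (C * 0 : R).
  by apply: cvgMr; exact: hA.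
rewrite mulr0 => /cvgr_lt /(_ (normc (v 0 j))) h.
have vjp : 0 < normc (v 0 j).
  rewrite lt_def normc_ge0 andbT; apply: contra vj => /eqP.
  by move/ComplexField.Normc.eq0_normc ->.
case: (h vjp) => N _ /(_ N (leqnn N)) /=; apply/negP; rewrite -leNgt.
apply: le_trans (hC _).
rewrite map_mxM mulmxA pow -scalemxAl mxE ComplexField.Normc.normcM.
have -> : (v *m toC e) 0 0 = v 0 j.
  rewrite mxE (bigD1 j)//= big1; first by rewrite !mxE !eqxx mulr1 addr0.
  by move=> k kj; rewrite !mxE (negbTE kj) /= mulr0.
rewrite ler_peMl ?normc_ge0//.
elim: N => [|N IH]; first by rewrite expr0 ComplexField.Normc.normc1.
by rewrite exprS ComplexField.Normc.normcM mulr_ege1.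
Qed.

End SpectralRadius.

(** * Quadratic forms and the game Riccati equation *)

Section Forms.
Variable R : realType.

Lemma qformE n (M : 'M[R]_n) x : qform M x = dot x (M *m x).
Proof. by rewrite /qform /dot mulmxA. Qed.

Lemma dot_symmx n (M : 'M[R]_n) x y : M^T = M -> dot x (M *m y) = dot y (M *m x).
Proof. by move=> hM; rewrite dotC dot_mulmxl hM. Qed.

Lemma qformDsym n (M : 'M[R]_n) x y : M^T = M ->
  qform M (x + y) = qform M x + 2 * dot x (M *m y) + qform M y.
Proof.
move=> hM; rewrite !qformE mulmxDr !dotlin (dot_symmx y x hM); ring.
Qed.

Lemma unitmx_ker0 n (M : 'M[R]_n) :
  (forall x : 'cV_n, M *m x = 0 -> x = 0) -> M \in unitmx.
Proof.
move=> h; rewrite -unitmx_tr -row_free_unit; apply: inj_row_free => v vM.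
by apply: trmx_inj; rewrite trmx0; apply: h; rewrite -[M]trmxK -trmx_mul vM trmx0.
Qed.

Lemma pdmx_unit n (M : 'M[R]_n) : pdmx M -> M \in unitmx.
Proof.
move=> [_ hM]; apply: unitmx_ker0 => x Mx; apply: contrapT => /eqP /hM.
by rewrite qformE Mx dot0r ltxx.
Qed.

Lemma pdmx_psd n (M : 'M[R]_n) : pdmx M -> psdmx M.
Proof.
move=> [sM hM]; split=> // x; have [->|/hM/ltW//] := eqVneq x 0.
by rewrite qformE dot0l.
Qed.

Lemma invmx_psd n (M : 'M[R]_n) : psdmx M -> M \in unitmx -> psdmx (invmx M).
Proof.
move=> [sM hM] uM; split=> [|x]; first by rewrite trmx_inv sM.
rewrite qformE; have := hM (invmx M *m x).
by rewrite qformE mulmxA mulmxV// mul1mx dotC.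
Qed.

Lemma congr_psd n m (M : 'M[R]_m) (B : 'M[R]_(n, m)) : psdmx M ->
  psdmx (B *m M *m B^T).
Proof.
move=> [sM hM]; split=> [|x]; first by rewrite !trmx_mul trmxK sM mulmxA.
by rewrite qformE -!mulmxA dotC dot_mulmxl dotC -qformE.
Qed.

Lemma qform_le_specnorm n (M : 'M[R]_n) x : `|qform M x| <= specnorm M * enorm x ^+ 2.
Proof. by rewrite qformE expr2 normr_dot_mulmx. Qed.

Lemma qformB n (M N : 'M[R]_n) x : qform (M - N) x = qform M x - qform N x.
Proof. by rewrite !qformE mulmxBl !dotlin. Qed.

Lemma qformD n (M N : 'M[R]_n) x : qform (M + N) x = qform M x + qform N x.
Proof. by rewrite !qformE mulmxDl !dotlin. Qed.

Lemma qform_scalar n (a : R) (x : 'cV[R]_n) : qform a%:M x = a * dot x x.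
Proof. by rewrite qformE mul_scalar_mx dotlin. Qed.

Lemma qform0 n (x : 'cV[R]_n) : qform 0 x = 0.
Proof. by rewrite qformE mul0mx dot0r. Qed.

Lemma qform_conj n m (M : 'M[R]_n) (A : 'M[R]_(n, m)) x :
  qform (A^T *m M *m A) x = qform M (A *m x).
Proof. by rewrite !qformE -!mulmxA dotC dot_mulmxl trmxK dotC. Qed.

End Forms.

(** * The one-stage quadratic game *)

Section Game.
Variables (R : realType) (n m : nat) (B : 'M[R]_(n, m)) (Rc : 'M[R]_m).
Hypothesis hRc : pdmx Rc.
Local Notation Lambda := (hinf_Lambda B Rc).

Let D := B *m invmx Rc *m B^T.

Let D_psd : psdmx D.
Proof. exact: congr_psd (invmx_psd (pdmx_psd hRc) (pdmx_unit hRc)). Qed.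

Lemma hinf_Lambda_mulmx g N (x : 'cV_n) :
  Lambda g N *m x = x + D *m (N *m x) - g ^- 2 *: (N *m x).
Proof. by rewrite /hinf_Lambda mulmxDl mul1mx -mulmxA mulmxBl mul_scalar_mx addrA. Qed.

(** Let [Lambda x = 0] and [y = N x], nonzero. Pairing with [y] bounds the inner product of [x] and
    [y] by [g^-2 |y|^2], as [D] is nonnegative. Evaluating [N] at [x - g^-2 y] and using [N < g^2]
    at [y] gives the opposite strict inequality. *)
Lemma hinf_Lambda_unit g N : 0 < g -> psdmx N -> pdmx ((g ^+ 2)%:M - N) ->
  Lambda g N \in unitmx.
Proof.
move=> g0 [sN hN] [_ hgN]; apply: unitmx_ker0 => x.
rewrite hinf_Lambda_mulmx; set y := N *m x => Lx.
have [y0|yn0] := eqVneq y 0.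
  by move: Lx; rewrite y0 mulmx0 scaler0 subr0 addr0.
have h1 : dot y x + dot y (D *m y) - g ^- 2 * dot y y = 0.
  by have := congr1 (dot y) Lx; rewrite !dotlin.
have h2 : 0 <= dot y (D *m y) by rewrite -qformE; case: D_psd.
have h3 := hN (x - g ^- 2 *: y).
have h4 := hgN y yn0.
rewrite qformB qform_scalar subr_gt0 in h4.
rewrite qformDsym// qformE -/y mulmxN -scalemxAr !dotlin (dot_symmx x y sN) -/y in h3.
rewrite qformE mulmxN -scalemxAr !dotlin -(qformE N y) (dotC x y) in h3.
have p0 : 0 < g ^- 2 by rewrite invr_gt0 exprn_gt0.
have h5 : g ^- 2 * qform N y < dot y y.
  by rewrite mulrC ltr_pdivrMr ?exprn_gt0// mulrC.
have h6 := h5; rewrite -(ltr_pM2l p0) in h6.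
exfalso; nra.
Qed.

(** [N Lambda = N + N (D - g^-2) N] is symmetric, so [N Lambda = Lambda^T N], and the inverses can
    be moved across. *)
Lemma hinf_value_sym g N : N^T = N -> Lambda g N \in unitmx ->
  (N *m invmx (Lambda g N))^T = N *m invmx (Lambda g N).
Proof.
move=> sN uL; rewrite trmx_mul trmx_inv sN.
have e : N *m Lambda g N = (Lambda g N)^T *m N.
  have e1 : (D - (g ^- 2)%:M)^T = D - (g ^- 2)%:M.
    by rewrite [LHS]linearB/= tr_scalar_mx; case: D_psd => -> _.
  rewrite /hinf_Lambda -/D [X in _ = X *m _]linearD/= trmx1 trmx_mul sN e1.
  by rewrite [RHS]mulmxDl mul1mx mulmxDr mulmx1 !mulmxA.
apply: (can_inj (mulmxK uL)); rewrite mulmxKV//.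
by rewrite -mulmxA e mulmxA mulVmx ?unitmx_tr// mul1mx.
Qed.

(** One stage with cost-to-go [N] from the uncontrolled successor [x]: [u] minimises and [w]
    maximises. The pair [game_u], [game_w] is the critical point. *)
Definition game (g : R) (N : 'M[R]_n) (x : 'cV[R]_n) u w : R :=
  qform Rc u - g ^+ 2 * dot w w + qform N (x + B *m u + w).

Definition game_u g N x : 'cV[R]_m :=
  - (invmx Rc *m (B^T *m (N *m (invmx (Lambda g N) *m x)))).

Definition game_w g N x : 'cV[R]_n := g ^- 2 *: (N *m (invmx (Lambda g N) *m x)).

Lemma game_next g N x : Lambda g N \in unitmx ->
  x + B *m game_u g N x + game_w g N x = invmx (Lambda g N) *m x.
Proof.
move=> uL; set z := invmx _ *m x.
have e : B *m game_u g N x = - (D *m (N *m z)) by rewrite mulmxN /D -!mulmxA.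
have e1 : x = z + D *m (N *m z) - g ^- 2 *: (N *m z).
  by rewrite -hinf_Lambda_mulmx mulKVmx.
by rewrite e {1}e1 /game_w -/z addrAC subrK addrK.
Qed.

(** A quadratic function is its value at a critical point plus its second-order part. With [z] the
    successor state, criticality reads [Rc u0 = - B^T N z] and [g^2 w0 = N z]. This is an identity;
    signs enter only where it is applied. *)
Lemma game_saddle g N x u w : g != 0 -> N^T = N -> Lambda g N \in unitmx ->
  game g N x u w = qform (N *m invmx (Lambda g N)) x
    + qform Rc (u - game_u g N x)
    - g ^+ 2 * dot (w - game_w g N x) (w - game_w g N x)
    + qform N (B *m (u - game_u g N x) + (w - game_w g N x)).
Proof.
move=> g0 sN uL; set z := invmx (Lambda g N) *m x.
set u0 := game_u g N x; set w0 := game_w g N x.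
have hz : x + B *m u0 + w0 = z by exact: game_next.
rewrite /game -{1 2}(subrK u0 u) -{1 2 3}(subrK w0 w).
move: (u - u0) (w - w0) => du dw.
have -> : x + B *m (du + u0) + (dw + w0) = z + (B *m du + dw).
  rewrite -hz mulmxDr; apply/matrixP => i j; rewrite !mxE; ring.
have [sR _] := hRc; set y := N *m z.
have Ru0 : Rc *m u0 = - (B^T *m y).
  by rewrite mulmxN mulKVmx// pdmx_unit.
have hx : x = z - B *m u0 - w0 by rewrite -hz; apply/matrixP => i j; rewrite !mxE; ring.
have h1 : qform Rc (du + u0) = qform Rc du - 2 * dot (B *m du) y - dot (B *m u0) y.
  rewrite qformDsym// (qformE Rc u0) Ru0 !dotNr.
  by rewrite -!dot_mulmxl mulrN.
have h2 : dot (dw + w0) (dw + w0)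
    = dot dw dw + 2 * (g ^- 2 * dot dw y) + g ^- 2 * (g ^- 2 * dot y y).
  rewrite !dotDl !dotDr (dotC w0 dw) /w0 /game_w -/z -/y !dotZl !dotZr; ring.
have h3 : qform N (z + (B *m du + dw))
    = dot z y + 2 * (dot (B *m du) y + dot dw y) + qform N (B *m du + dw).
  by rewrite qformDsym// (qformE N z) (dot_symmx z _ sN) dotDl.
have h4 : qform (N *m invmx (Lambda g N)) x
    = dot z y - dot (B *m u0) y - g ^- 2 * dot y y.
  rewrite (qformE _ x) -mulmxA -/z -/y hx !dotDl !dotNl.
  by rewrite /w0 /game_w -/z -/y dotZl.
by rewrite h1 h2 h3 h4; field.
Qed.

(** Both games are evaluated at the mixed pair made of the minimiser of game 2 and the maximiser of
    game 1. There game 1 is at least its own value, game 2 is at most its own value because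
    [N2 <= g2^2], and game 1 lies below game 2 pointwise. *)
Lemma game_value_mono g1 g2 N1 N2 x : 0 < g2 <= g1 -> psdmx N1 -> N2^T = N2 ->
  (forall y, qform N1 y <= qform N2 y) ->
  (forall y, qform N2 y <= g2 ^+ 2 * dot y y) ->
  Lambda g1 N1 \in unitmx -> Lambda g2 N2 \in unitmx ->
  qform (N1 *m invmx (Lambda g1 N1)) x <= qform (N2 *m invmx (Lambda g2 N2)) x.
Proof.
move=> /andP[g20 g21] [sN1 hN1] sN2 N12 N2g u1 u2.
have g10 := lt_le_trans g20 g21.
have s1 := game_saddle x (game_u g2 N2 x) (game_w g1 N1 x) (lt0r_neq0 g10) sN1 u1.
have s2 := game_saddle x (game_u g2 N2 x) (game_w g1 N1 x) (lt0r_neq0 g20) sN2 u2.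
rewrite (subrr (game_w _ _ _)) dot0l mulr0 subr0 addr0 in s1.
rewrite (subrr (game_u _ _ _)) (qformE Rc 0) dot0l mulmx0 add0r addr0 in s2.
move: s1 s2; rewrite /game; set w1 := game_w g1 N1 x; set dw := w1 - _; set du := _ - game_u _ _ _.
set y := _ + w1; have hy := N12 y.
have h1 := N2g dw; have [_ hR] := pdmx_psd hRc.
have := hR du; have := hN1 (B *m du).
have : g2 ^+ 2 * dot w1 w1 <= g1 ^+ 2 * dot w1 w1.
  by rewrite ler_wpM2r ?dotxx_ge0// lerXn2r// nnegrE ltW.
lra.
Qed.

End Game.

(** * Entrywise limits and monotone sequences of quadratic forms *)

Section MatrixLimits.
Variable R : realType.

Definition mxcvg p q (N : nat -> 'M[R]_(p, q)) (L : 'M[R]_(p, q)) : Prop :=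
  forall i j, (fun k => N k i j) @ \oo --> L i j.

Lemma mxcvg_cst p q (L : 'M[R]_(p, q)) : mxcvg (fun=> L) L.
Proof. by move=> i j; exact: cvg_cst. Qed.

Lemma mxcvgD p q (N M : nat -> 'M[R]_(p, q)) L K :
  mxcvg N L -> mxcvg M K -> mxcvg (fun k => N k + M k) (L + K).
Proof.
move=> hN hM i j; rewrite mxE; under eq_fun do rewrite mxE.
exact: cvgD (hN i j) (hM i j).
Qed.

Lemma mxcvg_mul p q r (N : nat -> 'M[R]_(p, q)) (M : nat -> 'M[R]_(q, r)) L K :
  mxcvg N L -> mxcvg M K -> mxcvg (fun k => N k *m M k) (L *m K).
Proof.
move=> hN hM i j; rewrite mxE; under eq_fun do rewrite mxE.
apply: cvg_big => [|l _]; first exact: add_continuous.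
exact: cvgM (hN i l) (hM l j).
Qed.

Lemma mxcvg_unique p q (N : nat -> 'M[R]_(p, q)) L K :
  mxcvg N L -> mxcvg N K -> L = K.
Proof.
move=> hL hK; apply/matrixP => i j.
exact: cvg_unique (hL i j) (hK i j).
Qed.

Lemma mxcvg_shift p q (N : nat -> 'M[R]_(p, q)) L :
  mxcvg N L -> mxcvg (fun k => N k.+1) L.
Proof. by move=> h i j; have := h i j; rewrite -(cvg_shiftS (fun k => N k i j)). Qed.

Lemma mxcvg_qform n (N : nat -> 'M[R]_n) L x :
  mxcvg N L -> (fun k => qform (N k) x) @ \oo --> qform L x.
Proof.
move=> h; have h1 : mxcvg (fun k => x^T *m N k) (x^T *m L).
  by apply: mxcvg_mul => //; exact: mxcvg_cst.
have h2 : mxcvg (fun k => x^T *m N k *m x) (x^T *m L *m x).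
  by apply: mxcvg_mul => //; exact: mxcvg_cst.
exact: (h2 0 0).
Qed.

Lemma mx_monotone_cvg n (N : nat -> 'M[R]_n) (U : 'cV[R]_n -> R) :
  (forall k, (N k)^T = N k) ->
  (forall k x, qform (N k) x <= qform (N k.+1) x) ->
  (forall k x, qform (N k) x <= U x) ->
  exists2 L, mxcvg N L & L^T = L.
Proof.
move=> sN mN bN.
have cq x : cvgn (fun k => qform (N k) x).
  apply: nondecreasing_is_cvgn; first by apply/nondecreasing_seqP => k; exact: mN.
  by exists (U x) => _ [k _ <-]; exact: bN.
have ce i j : cvgn (fun k => N k i j).
  pose e i : 'cV[R]_n := delta_mx i 0.
  (* Polarization on basis vectors turns convergence of the quadratic forms into convergence of the
     entries. *)
  have -> : (fun k => N k i j) = (fun k => 2^-1 *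
      (qform (N k) (e i + e j) - qform (N k) (e i) - qform (N k) (e j))).
    apply/funext => k; rewrite qformDsym//.
    have -> : dot (e i) (N k *m e j) = N k i j.
      by rewrite /dot trmx_delta -rowE -colE !mxE.
    by field.
    pose q x := limn (fun k => qform (N k) x).
  apply: (cvgP (2^-1 * (q (e i + e j) - q (e i) - q (e j)))).
  apply: cvgM; first exact: cvg_cst.
  by apply: cvgB; [apply: cvgB |]; exact: cq.
pose L := \matrix_(i, j) limn (fun k => N k i j).
have hL : mxcvg N L by move=> i j; rewrite mxE; exact: ce.
exists L => //; apply/matrixP => i j; rewrite !mxE; congr (limn _).
by apply/funext => k; rewrite -[in RHS](sN k) mxE.
Qed.

End MatrixLimits.

Section RiccatiComparison.
Variables (R : realType) (n m : nat) (A : 'M[R]_n) (B : 'M[R]_(n, m)).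
Variables (Q : 'M[R]_n) (Rc : 'M[R]_m).
Hypotheses (hQ : psdmx Q) (hRc : pdmx Rc).
Local Notation Lambda := (hinf_Lambda B Rc).

(* Value iteration at level [g1], started at 0, increases and stays below any
   feasible solution at a smaller level [g2]. *)
Lemma hinf_riccati_below g1 g2 N2 : 0 < g2 <= g1 ->
  hinf_riccati A B Q Rc g2 N2 -> pdmx ((g2 ^+ 2)%:M - N2) ->
  exists2 N, hinf_riccati A B Q Rc g1 N & forall x, qform N x <= qform N2 x.
Proof.
move=> g12 [pN2 u2 eN2] hg2.
have /andP[g20 g21] := g12; have g10 := lt_le_trans g20 g21.
pose V N := N *m invmx (Lambda g1 N).
pose F N := Q + A^T *m V N *m A.
pose adm N := psdmx N /\ forall x, qform N x <= qform N2 x.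
have N2g x : qform N2 x <= g2 ^+ 2 * dot x x.
  by have [_ /(_ x)] := pdmx_psd hg2; rewrite qformB qform_scalar subr_ge0.
have g2g1 (x : 'cV[R]_n) : g2 ^+ 2 * dot x x <= g1 ^+ 2 * dot x x.
  by rewrite ler_wpM2r ?dotxx_ge0// lerXn2r// nnegrE ltW.
(* Below [N2 < g2^2 <= g1^2] the matrix [g1^2 - N] stays positive definite, so [Lambda] is
   invertible along the whole iteration and at its limit. *)
have uA N : adm N -> Lambda g1 N \in unitmx.
  move=> [pN hN]; apply: hinf_Lambda_unit => //; split.
    by rewrite linearB/= tr_scalar_mx; case: pN => -> _.
  move=> x x0; have [_ /(_ x x0)] := hg2.
  rewrite !qformB !qform_scalar; have := hN x; have := g2g1 x; lra.
have Vmono N N' x : adm N -> adm N' -> (forall y, qform N y <= qform N' y) ->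
    qform (V N) x <= qform (V N') x.
  move=> aN aN' NN'; apply: game_value_mono => //; try exact: uA.
  - by rewrite g10 lexx.
  - by case: aN.
  - by case: aN' => -[].
  - by move=> y; case: aN' => _ /(_ y); have := N2g y; have := g2g1 y; lra.
(* [N2] is a fixed point at level [g2], so this comparison of values keeps the iterates below [N2]
   and also bounds the values uniformly. *)
have V2 N x : adm N -> qform (V N) x <= qform (N2 *m invmx (Lambda g2 N2)) x.
  move=> aN; apply: game_value_mono => //; try exact: uA; last by case: aN.
  - by case: aN.
  - by case: pN2.
have adm0 : adm 0.
  split; last by move=> x; rewrite qform0; case: pN2.
  by split=> [|x]; rewrite ?trmx0 ?qform0.
have V0 x : qform (V 0) x = 0 by rewrite /V mul0mx qform0.
have Vsym N : adm N -> (V N)^T = V N.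
  by move=> aN; apply: hinf_value_sym => //; [case: aN => -[] | exact: uA].
have Vpos N x : adm N -> 0 <= qform (V N) x.
  move=> aN; rewrite -(V0 x); apply: Vmono => // y; rewrite qform0.
  by case: aN => -[].
have qF N x : qform (F N) x = qform Q x + qform (V N) (A *m x).
  by rewrite qformD qform_conj.
have admF N : adm N -> adm (F N).
  move=> aN; split; first split.
  - rewrite [LHS]linearD/= (trmx_mul _ A) (trmx_mul _ (V N)) trmxK Vsym// mulmxA.
    by case: hQ => ->.
  - by move=> x; rewrite qF addr_ge0 ?Vpos//; case: hQ.
  - move=> x; rewrite qF eN2 -!mulmxA [_ *m (_ *m A)]mulmxA mulmxA qformD qform_conj.
    by rewrite lerD2l V2.
pose N k := iter k F 0.
have aN k : adm (N k) by elim: k => [//|k]; exact: admF.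
have mN k x : qform (N k) x <= qform (N k.+1) x.
  elim: k x => [|k IH] x.
    by rewrite /N/= qform0; case: (admF _ adm0) => -[].
  by rewrite [N k.+1]/(F (N k)) [N k.+2]/(F (N k.+1)) !qF lerD2l Vmono.
have sN k : (N k)^T = N k by case: (aN k) => -[].
have [L hL sL] := mx_monotone_cvg sN mN (fun k x => (aN k).2 x).
(* The values get a monotone limit of their own, which avoids continuity of the matrix inverse: [Y]
   is identified afterwards by passing to the limit in the polynomial identity
   [V N * Lambda N = N]. *)
have [Y hY sY] : exists2 Y, mxcvg (fun k => V (N k)) Y & Y^T = Y.
  apply: (@mx_monotone_cvg _ _ _ (qform (N2 *m invmx (Lambda g2 N2)))).
  - by move=> k; exact: Vsym.
  - by move=> k x; apply: Vmono.
  - by move=> k x; exact: V2.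
have aL : adm L.
  split; first split=> // x.
  -   - apply: (cvgr_to_ge (@mxcvg_qform _ _ _ _ x hL)); apply: nearW => k.
    by case: (aN k) => -[].
  - move=> x; apply: (cvgr_to_le (@mxcvg_qform _ _ _ _ x hL)); apply: nearW => k.
    by case: (aN k).
have YL : Y *m Lambda g1 L = L.
  apply: (@mxcvg_unique _ _ _ (fun k => V (N k) *m Lambda g1 (N k))).
    apply: mxcvg_mul => //; apply: mxcvgD; first exact: mxcvg_cst.
    by apply: mxcvg_mul => //; exact: mxcvg_cst.
  suff -> : (fun k => V (N k) *m Lambda g1 (N k)) = N by [].
  by apply/funext => k; rewrite /V mulmxKV// uA.
have YV : Y = L *m invmx (Lambda g1 L) by rewrite -{1}YL mulmxK// uA.
exists L; last by case: aL.
split; [by case: aL | exact: uA |].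
rewrite -(mulmxA A^T L) -YV.
apply: (mxcvg_unique (mxcvg_shift hL)).
apply: mxcvgD; first exact: mxcvg_cst.
by apply: mxcvg_mul; [apply: mxcvg_mul => //|]; exact: mxcvg_cst.
Qed.

(** An infimum below [g] yields a feasible level [g2 < g] with solution [N2]. A solution [N] at
    level [g] lies below [N2], and minimality gives [M <= N <= N2 < g2^2 <= g^2]. *)
Lemma hinf_minimal_feasible g M : (gamma_low A B Q Rc < g%:E)%E ->
  hinf_minimal A B Q Rc g M -> 0 < g /\ pdmx ((g ^+ 2)%:M - M).
Proof.
move=> /ereal_inf_lt[_ [g2 [g20 [N2 [[rN2 _] pN2]] <-]]]; rewrite lte_fin => g2g.
move=> [[[sM _] _ _] minM]; have g0 := lt_trans g20 g2g; split=> //.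
have [|N rN NN2] := @hinf_riccati_below g g2 N2 _ rN2 pN2; first by rewrite g20 ltW.
split=> [|x x0]; first by rewrite linearB/= tr_scalar_mx sM.
have [_ /(_ x)] := minM N rN; have [_ /(_ x x0)] := pN2.
rewrite !qformB !qform_scalar; have := NN2 x.
have : g2 ^+ 2 * dot x x <= g ^+ 2 * dot x x.
  by rewrite ler_wpM2r ?dotxx_ge0// lerXn2r ?nnegrE ?ltW.
lra.
Qed.

End RiccatiComparison.

(** * Stability from detectability *)

Section Detectability.
Variable R : realType.

(** Nonnegativity of [Q] at [x - k^-1 Q x] with [k = specnorm Q + 1]; the added 1 makes [k]
    invertible even when [Q = 0]. *)
Lemma psd_sqr_mulmx_le n (Q : 'M[R]_n) x : psdmx Q ->
  enorm (Q *m x) ^+ 2 <= (specnorm Q + 1) * qform Q x.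
Proof.
move=> [sQ hQ]; set y := Q *m x; set k := specnorm Q + 1.
have k0 : 0 < k by rewrite ltr_wpDl// specnorm_ge0.
have := hQ (x - k^-1 *: y).
rewrite qformDsym// (dot_symmx x _ sQ) -/y dotNl dotZl -enorm_sqr.
rewrite (qformE _ (- _)) mulmxN -scalemxAr !dotlin -(qformE Q y).
have hy := le_trans (ler_norm _) (qform_le_specnorm Q y).
have hy' : qform Q y <= k * enorm y ^+ 2.
  by rewrite (le_trans hy)// ler_wpM2r ?sqr_ge0// lerDl.
have -> : - (- (k^-1 * (k^-1 * qform Q y))) = k^-1 * (k^-1 * qform Q y) by rewrite opprK.
have : k^-1 * (k^-1 * qform Q y) <= k^-1 * enorm y ^+ 2.
  by rewrite ler_wpM2l ?invr_ge0 ?(ltW k0)// ler_pdivrMl.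
move=> h1 h2; rewrite -ler_pdivrMl//; lra.
Qed.

(** Coercivity from invertibility: [|x| <= |Q^-1| |Q x|], and [|Q x|^2] is controlled by the form.
    No smallest eigenvalue is needed. *)
Lemma pd_sqr_le n (Q : 'M[R]_n) : pdmx Q ->
  exists2 k, 0 <= k & forall x, enorm x ^+ 2 <= k * qform Q x.
Proof.
move=> pQ; exists (specnorm (invmx Q) ^+ 2 * (specnorm Q + 1)).
  by rewrite mulr_ge0 ?sqr_ge0// addr_ge0 ?specnorm_ge0.
move=> x; rewrite -mulrA.
apply: le_trans (ler_wpM2l (sqr_ge0 _) (psd_sqr_mulmx_le x (pdmx_psd pQ))).
rewrite -exprMn lerXn2r ?nnegrE ?mulr_ge0 ?enorm_ge0 ?specnorm_ge0//.
apply: le_trans (specnorm_mulmx _ _).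
by rewrite mulKmx// pdmx_unit.
Qed.

Lemma l2_bounded_mulmx n p (L : 'M[R]_(p, n)) (x : nat -> 'cV[R]_n) :
  l2_bounded (fun t => enorm (x t)) -> l2_bounded (fun t => enorm (L *m x t)).
Proof.
by apply: (@l2_bounded_le _ (specnorm L)) => t; rewrite enorm_ge0 specnorm_mulmx.
Qed.

Lemma l2_bounded_enormD n (x y : nat -> 'cV[R]_n) :
  l2_bounded (fun t => enorm (x t)) -> l2_bounded (fun t => enorm (y t)) ->
  l2_bounded (fun t => enorm (x t + y t)).
Proof.
move=> hx hy; apply: (@l2_bounded_le _ 1) (l2_boundedD hx hy) => t.
by rewrite mul1r enorm_ge0 enormD.
Qed.

(** Output injection: [x] is driven through the stable matrix [A - L Q] by [L (Q x) + b], and a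
    finite state cost makes [Q x] square summable. *)
Lemma detectable_l2_bounded n (A Q : 'M[R]_n) (x b : nat -> 'cV[R]_n) C :
  detectable A Q -> psdmx Q ->
  (forall t, x t.+1 = A *m x t + b t) ->
  l2_bounded (fun t => enorm (b t)) ->
  (forall T, \sum_(0 <= t < T) qform Q (x t) <= C) ->
  l2_bounded (fun t => enorm (x t)).
Proof.
move=> [L hL] pQ xS hb hC.
apply: (@spectral_radius_lt1_l2 _ _ (A - L *m Q) _ (fun t => L *m (Q *m x t) + b t)) => //.
  by move=> t; rewrite xS mulmxBl -mulmxA addrA subrK.
apply: l2_bounded_enormD => //; apply: l2_bounded_mulmx.
apply: (@l2_bounded_sum _ _ ((specnorm Q + 1) * C)) => T.
apply: (@le_trans _ _ (\sum_(0 <= t < T) (specnorm Q + 1) * qform Q (x t))).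
  by apply: ler_sum => t _; exact: psd_sqr_mulmx_le.
by rewrite -mulr_sumr ler_wpM2l// addr_ge0// specnorm_ge0.
Qed.

End Detectability.

Section HinfLoop.
Variables (R : realType) (n m : nat) (A : 'M[R]_n) (B : 'M[R]_(n, m)).
Variables (Q : 'M[R]_n) (Rc : 'M[R]_m) (g : R) (M : 'M[R]_n).
Hypotheses (hQ : psdmx Q) (hRc : pdmx Rc) (g0 : 0 < g).
Hypotheses (hM : hinf_riccati A B Q Rc g M) (hgM : pdmx ((g ^+ 2)%:M - M)).
Let K := hinf_gain A B Rc g M.
Let F := A - B *m K.

Lemma game_u_hinf_gain x : game_u B Rc g M (A *m x) = - (K *m x).
Proof. by rewrite /game_u /K /hinf_gain !mulmxA. Qed.

(** The saddle identity at zero disturbance: the remaining term is minus the form of [g^2 - M] at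
    the worst disturbance. Hence [M] is a Lyapunov function of the undisturbed loop. *)
Lemma hinf_value_decrease x :
  qform Q x + qform Rc (K *m x) + qform M (F *m x) <= qform M x.
Proof.
have [[sM pM] uL eM] := hM.
have := game_saddle hRc (A *m x) (- (K *m x)) 0 (lt0r_neq0 g0) sM uL.
rewrite game_u_hinf_gain subrr (qformE Rc 0) dot0l addr0 mulmx0 add0r /game.
rewrite dot0l mulr0 subr0 addr0 mulmxN mulmxA -mulmxBl -/F.
have eM' : M = Q + A^T *m (M *m invmx (hinf_Lambda B Rc g M)) *m A.
  by rewrite {1}eM !mulmxA.
rewrite [in qform M x]eM' qformD qform_conj.
rewrite !sub0r dotNl dotNr opprK.
set w := game_w _ _ _ _ _; have := (pdmx_psd hgM).2 w.
rewrite qformB qform_scalar.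
have -> : qform M (- w) = qform M w by rewrite !qformE mulmxN dotNl dotNr opprK.
have -> : qform Rc (- (K *m x)) = qform Rc (K *m x).
  by rewrite !qformE mulmxN dotNl dotNr opprK.
lra.
Qed.

(** The decrease of [M] telescopes to a finite total stage cost on every free trajectory, so
    detectability makes the trajectory square summable and it tends to 0. *)
Lemma hinf_spectral_radius_lt1 : detectable A Q -> spectral_radius F < 1.
Proof.
move=> hdet; apply: l2_powers_spectral_radius_lt1 => x.
apply: l2_bounded_cvg0; pose y t := F ^+ t *m x.
have yS t : y t.+1 = F *m y t by rewrite /y exprS -mulmxE mulmxA.
have sumle T : \sum_(0 <= t < T) (qform Q (y t) + qform Rc (K *m y t))
    <= qform M x - qform M (y T).
  elim: T => [|T IH]; first by rewrite big_geq// /y expr0 mul1mx subrr.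
  rewrite yS big_nat_recr//=; have := hinf_value_decrease (y T); lra.
have Mpos z : 0 <= qform M z by have [[_ pM] _ _] := hM.
have Qpos z : 0 <= qform Q z by case: hQ.
have Rpos z : 0 <= qform Rc z by case: (pdmx_psd hRc).
apply: (@detectable_l2_bounded _ _ A Q y (fun t => B *m (- (K *m y t))) (qform M x)) => //.
- by move=> t; rewrite [LHS]yS mulmxN (mulmxA B K) -mulmxBl.
- apply: l2_bounded_mulmx; have [k k0 hk] := pd_sqr_le hRc.
  apply: (@l2_bounded_sum _ _ (k * qform M x)) => T.
  apply: (@le_trans _ _ (\sum_(0 <= t < T) k * qform Rc (K *m y t))).
    by apply: ler_sum => t _; rewrite enormN.
  rewrite -mulr_sumr ler_wpM2l//.
  apply: (@le_trans _ _ (\sum_(0 <= t < T) (qform Q (y t) + qform Rc (K *m y t)))).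
    by apply: ler_sum => t _; rewrite lerDr.
  by rewrite (le_trans (sumle T))// gerBl.
- move=> T.
  apply: (@le_trans _ _ (\sum_(0 <= t < T) (qform Q (y t) + qform Rc (K *m y t)))).
    by apply: ler_sum => t _; rewrite lerDl.
  by rewrite (le_trans (sumle T))// gerBl.
Qed.

End HinfLoop.

(** * The offline linear-quadratic problem *)

Section LinearQuadratic.
Variables (R : realType) (n m : nat) (A : 'M[R]_n) (B : 'M[R]_(n, m)).
Variables (Q : 'M[R]_n) (Rc : 'M[R]_m) (P : 'M[R]_n).
Hypotheses (hQ : psdmx Q) (hRc : pdmx Rc) (hP : dare_stabilizing A B Q Rc P).
Let G := Rc + B^T *m P *m B.
Let K := dare_gain A B Rc P.
Let F := A - B *m K.
Let H := B *m invmx G *m B^T.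

Let sP : P^T = P. Proof. by case: hP. Qed.
Let uG : G \in unitmx. Proof. by case: hP. Qed.
Let sG : G^T = G.
Proof.
by rewrite /G linearD/= !trmx_mul trmxK sP mulmxA; case: hRc => ->.
Qed.
Let GK : G *m K = B^T *m P *m A.
Proof. by rewrite /K /dare_gain !mulmxA mulmxV// mul1mx. Qed.

Let KtG : K^T *m G = A^T *m P *m B.
Proof. by rewrite -{1}sG -trmx_mul GK !trmx_mul trmxK sP mulmxA. Qed.
Let dareE : P = Q + A^T *m P *m A - K^T *m G *m K.
Proof.
have [_ _ eP _] := hP; rewrite {1}eP KtG /K /dare_gain -/G.
by rewrite !mulmxA.
Qed.

Lemma dare_step x u :
  qform Q x + qform Rc u + qform P (A *m x + B *m u)
  = qform P x + qform G (u + K *m x).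
Proof.
have -> : qform P x = qform Q x + qform P (A *m x) - qform G (K *m x).
  by rewrite {1}dareE qformB qformD !qform_conj.
rewrite !qformDsym//.
have -> : qform G u = qform Rc u + qform P (B *m u) by rewrite qformD qform_conj.
have -> : dot u (G *m (K *m x)) = dot (A *m x) (P *m (B *m u)).
  rewrite mulmxA GK -!mulmxA (dot_symmx (A *m x) _ sP) [RHS]dotC.
  by rewrite dotC !dot_mulmxl trmxK -dot_mulmxl dotC.
ring.
Qed.

(** [P] decreases along the stable free loop, so [qform P x] is at least the limit of
    [qform P (F^t x)], which is 0. *)
Lemma dare_psd : psdmx P.
Proof.
split=> // x; have [_ _ _ F1] := hP.
have Pdec y : qform P (F *m y) <= qform P y.
  have := dare_step y (- (K *m y)); rewrite addNr (qformE G 0) dot0l addr0.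
  rewrite mulmxN mulmxA -mulmxBl -/F => <-.
  by rewrite lerDr addr_ge0//; [case: hQ | case: (pdmx_psd hRc)].
pose y t := F ^+ t *m x.
have yS t : y t.+1 = F *m y t + 0 by rewrite /y exprS -mulmxE mulmxA addr0.
have Py t : qform P (y t) <= qform P x.
  elim: t => [|t IH]; first by rewrite /y expr0 mul1mx.
  by rewrite yS addr0 (le_trans (Pdec _)).
have yl2 : l2_bounded (fun t => enorm (y t)).
  apply: (@spectral_radius_lt1_l2 _ _ F y (fun=> 0)) => //; last first.
  by apply: (@l2_bounded_sum _ _ 0) => T; rewrite big1// => t _; rewrite enorm0 expr0n.
have y0 := l2_bounded_cvg0 yl2.
have : (fun t => - specnorm P * (enorm (y t) * enorm (y t))) @ \oo
    --> (- specnorm P * (0 * 0) : R).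
  by apply: cvgM; [exact: cvg_cst | exact: cvgM].
rewrite !mulr0 => h; apply: (cvgr_to_le h); apply: nearW => t.
apply: le_trans (Py t); rewrite mulNr -expr2.
by have := qform_le_specnorm P (y t); rewrite ler_norml => /andP[].
Qed.

Lemma dare_weight_pd : pdmx G.
Proof.
split=> // u u0; rewrite /G qformD qform_conj.
by rewrite ltr_wpDr//; [case: dare_psd | case: hRc => _; exact].
Qed.

Let invG_psd : psdmx (invmx G).
Proof. exact: invmx_psd (pdmx_psd dare_weight_pd) uG. Qed.

(** The disturbance adds the cross term of [P w = s - F^T s'] with [A x + B u = F x + B (u + K x)].
    The input part of the [s] term is absorbed into the square, at the price of [- qform H s]; the
    state parts pair [F^T s] with [x] and [F^T s'] with [x'], and so telescope in time. *)
Lemma lq_step x u w s s' : s = P *m w + F^T *m s' ->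
  let x' := A *m x + B *m u + w in
  let v := G *m (u + K *m x) + B^T *m s in
  qform Q x + qform Rc u + qform P x' - qform P x
  = qform (invmx G) v - qform H s + qform P w + 2 * dot (F^T *m s') w
    + 2 * dot (F^T *m s) x - 2 * dot (F^T *m s') x'.
Proof.
move=> hs x' v; set y := A *m x + B *m u.
have yE : y = F *m x + B *m (u + K *m x).
  by rewrite /F mulmxBl mulmxDr mulmxA addrACA addNr addr0.
have -> : qform P x' = qform P y + 2 * dot (P *m w) y + qform P w.
  by rewrite /x' qformDsym// (dotC (P *m w)).
have h1 := dare_step x u; rewrite -/y in h1.
have h2 : qform (invmx G) v
    = qform G (u + K *m x) + 2 * dot s (B *m (u + K *m x)) + qform H s.
  rewrite /v qformDsym; last by case: invG_psd.
  rewrite !(qformE (invmx G)) mulKmx// (dotC (G *m _)) -qformE.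
  rewrite (dot_symmx _ (B^T *m s)) ?mulKmx//; last by case: invG_psd.
  rewrite dot_mulmxl trmxK; congr (_ + _).
  by rewrite -qformE -qform_conj trmxK.
have h3 : dot (P *m w) y = dot s y - dot (F^T *m s') y.
  by rewrite {1}hs dotDl addrK.
have h4 : dot s y = dot (F^T *m s) x + dot s (B *m (u + K *m x)).
  by rewrite {1}yE dotDr [dot (F^T *m s) x]dot_mulmxl trmxK.
have h5 : dot (F^T *m s') x' = dot (F^T *m s') y + dot (F^T *m s') w.
  by rewrite /x' dotDr.
rewrite h2 h5 h3 h4; lra.
Qed.

Lemma lq_sum T (u : nat -> 'cV_m) (w s : nat -> 'cV_n) x0 :
  (forall t, (t < T)%N -> s t = P *m w t + F^T *m s t.+1) ->
  let x := traj A B u w x0 in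
  \sum_(0 <= t < T) (qform Q (x t) + qform Rc (u t)) + qform P (x T)
  = qform P x0 + 2 * dot (F^T *m s 0%N) x0 - 2 * dot (F^T *m s T) (x T)
    + \sum_(0 <= t < T) (qform P (w t) + 2 * dot (F^T *m s t.+1) (w t)
                         - qform H (s t))
    + \sum_(0 <= t < T) qform (invmx G) (G *m (u t + K *m x t) + B^T *m s t).
Proof.
move=> hs x; elim: T hs => [|T IH] hs.
  by rewrite !big_geq//= add0r !addr0 addrK.
rewrite !big_nat_recr//=.
have := IH (fun t tT => hs t (ltnW tT)).
have := lq_step (x T) (u T) (hs T (ltnSn T)).
rewrite -/(x T) -[A *m x T + B *m u T + w T]/(x T.+1) /=; lra.
Qed.

(* The fixed point of the costate recursion along the worst case is
   [P w + (M - P) x'], which makes the saddle-point input offline optimal. *)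
Lemma worst_case_costate (M : 'M[R]_n) (x x' w : 'cV[R]_n) (u : 'cV[R]_m) :
  M *m x = Q *m x + A^T *m (M *m x') ->
  Rc *m u = - (B^T *m (M *m x')) ->
  x' = A *m x + B *m u + w ->
  let s := P *m w + (M - P) *m x' in
  G *m (u + K *m x) + B^T *m s = 0 /\ F^T *m s = (M - P) *m x.
Proof.
move=> hMx hRu hx' s.
have sE : s = M *m x' - P *m (A *m x) - P *m (B *m u).
  rewrite /s mulmxBl {2}hx' !mulmxDr; apply/matrixP => i j; rewrite !mxE; ring.
have h1 : G *m (u + K *m x) + B^T *m s = 0.
  rewrite sE !mulmxBr -[B^T *m (M *m x')]opprK -hRu mulmxDr (mulmxA G) GK.
  rewrite mulmxDl -!mulmxA; apply/matrixP => i j; rewrite !mxE; ring.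
split=> //; rewrite /F linearB/= trmx_mul mulmxBl -mulmxA.
have -> : B^T *m s = - (G *m (u + K *m x)).
  by apply/eqP; rewrite -addr_eq0 addrC h1.
rewrite mulmxN opprK mulmxA KtG sE !mulmxBr mulmxDr.
have -> : A^T *m (M *m x') = M *m x - Q *m x by rewrite hMx addrC addKr.
have -> : (M - P) *m x = M *m x - P *m x by rewrite mulmxBl.
have -> : P *m x = Q *m x + A^T *m P *m A *m x - A^T *m P *m B *m K *m x.
  by rewrite {1}dareE KtG mulmxBl mulmxDl.
rewrite -!mulmxA.
apply/matrixP => i j; rewrite !mxE; ring.
Qed.

End LinearQuadratic.

(** * Perturbation bounds *)

Section DifferenceBounds.
Variables (R : realType) (n : nat).
Implicit Types (a b w : nat -> 'cV[R]_n).

Definition vl2 T a : R := l2 T (fun t => enorm (a t)).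

Lemma vl2_ge0 T a : 0 <= vl2 T a. Proof. exact: l2_ge0. Qed.

Lemma vl2D T a b : vl2 T (fun t => a t + b t) <= vl2 T a + vl2 T b.
Proof.
apply: le_trans (l2D _ _ _); apply: l2_le => t _.
by rewrite enorm_ge0 enormD.
Qed.

Lemma vl2_mulmx T p (M : 'M[R]_(p, n)) a :
  l2 T (fun t => enorm (M *m a t)) <= specnorm M * vl2 T a.
Proof.
rewrite -{1}(ger0_norm (specnorm_ge0 M)) -l2Z; apply: l2_le => t _.
by rewrite enorm_ge0 specnorm_mulmx.
Qed.

Lemma sum_dot_le T a b :
  \sum_(0 <= t < T) dot (a t) (b t) <= vl2 T a * vl2 T b.
Proof.
apply: le_trans (sum_mul_le_l2 _ _ _); apply: ler_sum => t _.
exact: dot_le_enorm.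
Qed.

Lemma sum_dot_diff T a b a' b' (da db sb sa : R) :
  vl2 T (fun t => a t - a' t) <= da -> vl2 T (fun t => b t - b' t) <= db ->
  vl2 T b <= sb -> vl2 T a' <= sa ->
  \sum_(0 <= t < T) (dot (a t) (b t) - dot (a' t) (b' t)) <= da * sb + sa * db.
Proof.
move=> hda hdb hsb hsa.
have -> : \sum_(0 <= t < T) (dot (a t) (b t) - dot (a' t) (b' t))
  = \sum_(0 <= t < T) dot (a t - a' t) (b t)
    + \sum_(0 <= t < T) dot (a' t) (b t - b' t).
  by rewrite -big_split/=; apply: eq_bigr => t _; rewrite !dotlin; ring.
by rewrite lerD// (le_trans (sum_dot_le _ _ _))// ler_pM ?vl2_ge0.
Qed.

Lemma sum_dot_mulmx_diff T (M : 'M[R]_n) a b a' b' (da db sb sa : R) :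
  vl2 T (fun t => a t - a' t) <= da -> vl2 T (fun t => b t - b' t) <= db ->
  vl2 T b <= sb -> vl2 T a' <= sa ->
  \sum_(0 <= t < T) (dot (a t) (M *m b t) - dot (a' t) (M *m b' t))
    <= specnorm M * (da * sb + sa * db).
Proof.
move=> hda hdb hsb hsa.
have -> : specnorm M * (da * sb + sa * db)
    = da * (specnorm M * sb) + sa * (specnorm M * db) by ring.
apply: (@sum_dot_diff T a (fun t => M *m b t) a' (fun t => M *m b' t)) => //.
- under [X in vl2 T X]eq_fun do rewrite -mulmxBr.
  by rewrite (le_trans (vl2_mulmx _ _ _))// ler_wpM2l// specnorm_ge0.
- by rewrite (le_trans (vl2_mulmx _ _ _))// ler_wpM2l// specnorm_ge0.
Qed.

End DifferenceBounds.

Section StableLoop.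
Variables (R : realType) (n : nat) (F : 'M[R]_n) (c lam : R).
Hypotheses (c1 : 1 < c) (lam0 : 0 <= lam) (lam1 : lam < 1).
Hypothesis hF : forall i : nat, (1 <= i)%N -> specnorm (F ^+ i) <= c * lam ^+ i.
Implicit Types (w x : nat -> 'cV[R]_n) (P : 'M[R]_n).

Let c0 : 0 <= c. Proof. by rewrite ltW// (lt_trans _ c1). Qed.

(** The assumption covers only [i >= 1]; for [i = 0] the bound is [c > 1]. *)
Lemma pow_mulmx_le i (y : 'cV[R]_n) :
  enorm (F ^+ i *m y) <= c * lam ^+ i * enorm y /\
  enorm ((F ^+ i)^T *m y) <= c * lam ^+ i * enorm y.
Proof.
case: i => [|i].
  by rewrite !expr0 trmx1 mul1mx mulr1 ler_peMl ?enorm_ge0// ltW.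
split; [apply: le_trans (specnorm_mulmx _ _) _ | apply: le_trans (specnorm_trmulmx _ _) _].
all: by rewrite ler_wpM2r ?enorm_ge0 ?hF.
Qed.

(* Starting one step ahead of the state, [F x_t], makes every power of [F] at
   least 1, whence the factor [lam] in the bound. *)
Lemma forward_response_le w x T :
  (forall t, x t.+1 = F *m x t + w t) ->
  vl2 T (fun t => F *m x t) <= c * (lam / (1 - lam)) * (enorm (x 0%N) + vl2 T w).
Proof.
move=> xS.
have xE t : F *m x t = F ^+ t.+1 *m x 0%N + \sum_(0 <= i < t) F ^+ (t - i) *m w i.
  elim: t => [|t IH]; first by rewrite big_geq// addr0 expr1.
  rewrite xS IH !mulmxDr big_nat_recr//= subSnn expr1 addrA mulmx_sumr.
  congr (_ + _ + _); first by rewrite mulmxA mulmxE -exprS.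
  apply: eq_big_nat => i /andP[_ it].
  by rewrite mulmxA mulmxE -exprS subSn// ltnW.
pose h t := lam ^+ t.+1 * enorm (x 0%N) + \sum_(0 <= i < t) lam ^+ (t - i) * enorm (w i).
have hS t : h t.+1 = lam * (h t + enorm (w t)).
  rewrite /h big_nat_recr//= subSnn expr1 !mulrDr mulr_sumr addrA mulrA -exprS.
  congr (_ + _ + _); apply: eq_big_nat => i /andP[_ it].
  by rewrite mulrA -exprS subSn// ltnW.
have h0 t : 0 <= h t.
  rewrite addr_ge0 ?mulr_ge0 ?exprn_ge0 ?enorm_ge0//.
  by apply: sumr_ge0 => i _; rewrite mulr_ge0 ?exprn_ge0 ?enorm_ge0.
apply: (@le_trans _ _ (l2 T (fun t => c * h t))).
  apply: l2_le => t _; rewrite enorm_ge0 xE /h mulrDr mulr_sumr/=.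
  rewrite (le_trans (enormD _ _))// lerD//.
    by rewrite mulrA; case: (pow_mulmx_le t.+1 (x 0%N)).
  rewrite (le_trans (enorm_sum _ _ _))// ler_sum// => i _.
  by rewrite mulrA; case: (pow_mulmx_le (t - i) (w i)).
rewrite l2Z ger0_norm// -mulrA ler_wpM2l//.
apply: (@l2_forward_filter _ _ _ (fun t => enorm (w t))) => //.
- by rewrite lam0.
- exact: enorm_ge0.
- by move=> t; exact: enorm_ge0.
- by rewrite /h big_geq// addr0 expr1.
- by move=> t; rewrite hS.
Qed.

(** The feedforward sum of the offline optimal input, cut off at the horizon so that it vanishes at
    [T]. *)
Definition costate P T w t : 'cV[R]_n :=
  \sum_(t <= i < T) (F ^+ (i - t))^T *m (P *m w i).

Lemma costateB P T w w' t :
  costate P T w t - costate P T w' t = costate P T (fun t => w t - w' t) t.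
Proof.
rewrite -sumrB; apply: eq_bigr => i _; by rewrite -mulmxBr -mulmxBr.
Qed.

Lemma costate_end P T w : costate P T w T = 0.
Proof. by rewrite /costate big_geq. Qed.

Lemma trmulmx_costate P T w t :
  F^T *m costate P T w t = \sum_(t <= i < T) (F ^+ (i - t).+1)^T *m (P *m w i).
Proof.
rewrite mulmx_sumr; apply: eq_bigr => i _.
by rewrite mulmxA -trmx_mul mulmxE -exprSr.
Qed.

Lemma costate_rec P T w t : (t < T)%N ->
  costate P T w t = P *m w t + F^T *m costate P T w t.+1.
Proof.
move=> tT; rewrite {1}/costate big_ltn// subnn expr0 trmx1 mul1mx; congr (_ + _).
rewrite trmulmx_costate; apply: eq_big_nat => i /andP[ti _].
by rewrite subnSK.
Qed.

(** Scalar majorant of the costate, with an exact geometric recursion to which the backward filter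
    applies. *)
Let kap T w t := \sum_(t <= i < T) lam ^+ (i - t) * enorm (w i).

Let kap_ge0 T w t : 0 <= kap T w t.
Proof. by apply: sumr_ge0 => i _; rewrite mulr_ge0 ?exprn_ge0 ?enorm_ge0. Qed.

Let kap_l2 T w : l2 T (kap T w) <= vl2 T w / (1 - lam).
Proof.
apply: (@l2_backward_filter _ _ _ (fun t => enorm (w t))).
- by rewrite lam0.
- exact: kap_ge0.
- by rewrite /kap big_geq.
- move=> t tT; rewrite {1}/kap big_ltn// subnn expr0 mul1r lerD2l mulr_sumr.
  rewrite le_eqVlt; apply/orP; left; apply/eqP.
  by apply: eq_big_nat => i /andP[ti _]; rewrite mulrA -exprS subnSK.
Qed.

Let costate_kap P T w t : enorm (costate P T w t) <= c * specnorm P * kap T w t.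
Proof.
rewrite (le_trans (enorm_sum _ _ _))// mulr_sumr ler_sum// => i _.
have [_ h] := pow_mulmx_le (i - t) (P *m w i); apply: (le_trans h).
rewrite -!mulrA ler_wpM2l// mulrCA ler_wpM2l ?exprn_ge0//.
exact: specnorm_mulmx.
Qed.

Let trmulmx_costate_kap P T w t :
  enorm (F^T *m costate P T w t) <= c * specnorm P * lam * kap T w t.
Proof.
rewrite trmulmx_costate (le_trans (enorm_sum _ _ _))// mulr_sumr ler_sum// => i _.
have [_ h] := pow_mulmx_le (i - t).+1 (P *m w i); apply: (le_trans h).
rewrite [leRHS](_ : _ = c * lam ^+ (i - t).+1 * (specnorm P * enorm (w i))).
  by rewrite ler_wpM2l ?specnorm_mulmx// mulr_ge0// exprn_ge0.
by rewrite exprS; ring.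
Qed.

Lemma costate_l2_le P T w :
  vl2 T (costate P T w) <= c * specnorm P / (1 - lam) * vl2 T w.
Proof.
have cP : 0 <= c * specnorm P by rewrite mulr_ge0 ?specnorm_ge0.
apply: (@le_trans _ _ (l2 T (fun t => c * specnorm P * kap T w t))).
  by apply: l2_le => t _; rewrite enorm_ge0 costate_kap.
rewrite l2Z ger0_norm// -mulrA ler_wpM2l// mulrC; exact: kap_l2.
Qed.

Lemma trmulmx_costate0_le P T w :
  enorm (F^T *m costate P T w 0%N)
  <= specnorm P * (c * (lam / (1 - lam))) * vl2 T w.
Proof.
have cP : 0 <= c * specnorm P * lam by rewrite !mulr_ge0 ?specnorm_ge0.
apply: (le_trans (trmulmx_costate_kap P T w 0%N)).
have : kap T w 0%N <= vl2 T w / (1 - lam).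
  case: T => [|T]; last by apply: le_trans (le_l2 _ _) (kap_l2 _ _).
  by rewrite /kap big_geq// divr_ge0 ?vl2_ge0// subr_ge0 ltW.
move=> /(ler_wpM2l cP) h; apply: (le_trans h).
by rewrite le_eqVlt; apply/orP; left; apply/eqP; ring.
Qed.

Lemma trmulmx_costate_l2_le P T w :
  vl2 T (fun t => F^T *m costate P T w t.+1)
  <= specnorm P * (c * (lam / (1 - lam))) * vl2 T w.
Proof.
have cP : 0 <= c * specnorm P * lam by rewrite !mulr_ge0 ?specnorm_ge0.
apply: (@le_trans _ _ (l2 T (fun t => c * specnorm P * lam * kap T w t.+1))).
  by apply: l2_le => t _; rewrite enorm_ge0 trmulmx_costate_kap.
rewrite l2Z ger0_norm//.
have sh : l2 T (fun t => kap T w t.+1) <= l2 T (kap T w).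
  rewrite -(@ler_pXn2r _ 2) ?nnegrE ?l2_ge0// !l2_sqr.
  have := big_nat_recl T 0 (fun t => kap T w t ^+ 2) (leq0n T) (op := +%R) (idx := 0).
  rewrite big_nat_recr//= {2}/kap [X in X ^+ 2]big_geq// expr0n/= addr0 => ->.
  by rewrite lerDr sqr_ge0.
apply: (le_trans (ler_wpM2l cP (le_trans sh (kap_l2 T w)))).
by rewrite le_eqVlt; apply/orP; left; apply/eqP; ring.
Qed.

(** Any bound uniform in [T] suffices, since the sum later multiplies a terminal quantity tending to
    0. The induction closes because [1 - lam^2 (2 - lam) = (1 - lam) (1 + lam (1 - lam))]. *)
Lemma sum_geometric_sqr_le T : \sum_(0 <= t < T) (lam ^+ (T - t)) ^+ 2 <= (1 - lam)^-1.
Proof.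
have l1 : 0 < 1 - lam by rewrite subr_gt0.
elim: T => [|T IH]; first by rewrite big_geq// invr_ge0 ltW.
rewrite big_nat_recr//= subSnn expr1.
have -> : \sum_(0 <= t < T) (lam ^+ (T.+1 - t)) ^+ 2
    = lam ^+ 2 * \sum_(0 <= t < T) (lam ^+ (T - t)) ^+ 2.
  rewrite mulr_sumr; apply: eq_big_nat => t /andP[_ tT].
  by rewrite subSn ?(ltnW tT)// (exprS lam (T - t)) exprMn.
have h := ler_wpM2l (sqr_ge0 lam) IH.
have e : lam ^+ 2 / (1 - lam) + lam ^+ 2 = (1 - lam)^-1 * (lam ^+ 2 * (2 - lam)).
  by field; rewrite lt0r_neq0.
apply: (@le_trans _ _ (lam ^+ 2 / (1 - lam) + lam ^+ 2)); first by rewrite lerD2r.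
rewrite e ler_piMr ?invr_ge0 ?(ltW l1)//.
rewrite -subr_ge0 (_ : _ - _ = (1 - lam) * (1 + lam * (1 - lam))); last by ring.
by rewrite mulr_ge0 ?(ltW l1)// addr_ge0// mulr_ge0 ?(ltW l1).
Qed.

End StableLoop.

Section SequenceNorm.
Variables (R : realType) (n : nat).
Implicit Types w : nat -> 'cV[R]_n.

Lemma vl2_le_seqnorm w (C : R) T : (seqnorm w <= C%:E)%E -> vl2 T w <= C.
Proof.
rewrite /seqnorm; set S := (\sum_(0 <= t <oo) _)%E => hC.
have hT : ((vl2 T w ^+ 2)%:E <= S)%E.
  rewrite l2_sqr -sumEFin; apply: nneseries_lim_ge => t _ _.
  by rewrite lee_fin sqr_ge0.
case: S hC hT => [r| |]//=; rewrite !lee_fin => hC hT.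
apply: le_trans hC; rewrite -(@ler_pXn2r _ 2) ?nnegrE ?vl2_ge0 ?sqrtr_ge0//.
have r0 : 0 <= r := le_trans (sqr_ge0 _) hT.
by rewrite [leRHS]sqr_sqrtr.
Qed.

Lemma seqnorm_fin w (C : R) : (forall T, vl2 T w <= C) ->
  exists2 d, seqnorm w = d%:E & 0 <= d /\ forall T, vl2 T w <= d.
Proof.
move=> hC.
have : (0 <= \sum_(0 <= t <oo) (enorm (w t) ^+ 2)%:E)%E.
  by apply: nneseries_ge0 => t _ _; rewrite lee_fin sqr_ge0.
have : (\sum_(0 <= t <oo) (enorm (w t) ^+ 2)%:E <= (C ^+ 2)%:E)%E.
  apply: lime_le.
    by apply: is_cvg_nneseries => t _ _; rewrite lee_fin sqr_ge0.
  apply: nearW => T; rewrite sumEFin lee_fin -l2_sqr.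
  by rewrite lerXn2r ?nnegrE ?l2_ge0 ?(le_trans _ (hC T))// ?vl2_ge0 ?hC.
case e : (\sum_(0 <= t <oo) (enorm (w t) ^+ 2)%:E)%E => [r| |]// _ r0.
have ed : seqnorm w = (Num.sqrt r)%:E by rewrite /seqnorm e.
exists (Num.sqrt r) => //; split; first exact: sqrtr_ge0.
by move=> T; apply: vl2_le_seqnorm; rewrite ed.
Qed.

Lemma vl2_l2_bounded w (C : R) : (forall T, vl2 T w <= C) ->
  l2_bounded (fun t => enorm (w t)).
Proof. by exists C. Qed.

End SequenceNorm.

(** * Infinite-horizon cost *)

Section Cost.
Variables (R : realType) (n m : nat) (A : 'M[R]_n) (B : 'M[R]_(n, m)).
Variables (Q QT : 'M[R]_n) (Rc : 'M[R]_m).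
Hypotheses (hQ : psdmx Q) (hQT : psdmx QT) (hRc : pdmx Rc).
Hypothesis hdet : detectable A Q.

Definition stage_cost u (w : nat -> 'cV[R]_n) x0 T : R :=
  \sum_(0 <= t < T) (qform Q (traj A B u w x0 t) + qform Rc (u t)).

Lemma qform_cvg0 p (M : 'M[R]_p) (x : nat -> 'cV[R]_p) :
  l2_bounded (fun t => enorm (x t)) -> (fun t => qform M (x t)) @ \oo --> (0 : R).
Proof.
move=> hx; apply/norm_cvg0P.
have x0 := l2_bounded_cvg0 hx.
have h : (fun t => specnorm M * (enorm (x t) * enorm (x t))) @ \oo --> (0 : R).
  have := cvgM (cvg_cst (specnorm M)) (cvgM x0 x0).
  by rewrite !mulr0; exact.
apply: (squeeze_cvgr _ (cvg_cst (0 : R)) h); apply: nearW => t.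
by rewrite normr_ge0 -expr2 qform_le_specnorm.
Qed.

Lemma stage_cost_nondecreasing u w x0 : nondecreasing_seq (stage_cost u w x0).
Proof.
apply/nondecreasing_seqP => T; rewrite /stage_cost big_nat_recr//= lerDl.
by rewrite addr_ge0//; [case: hQ | case: (pdmx_psd hRc)].
Qed.

(** A finite stage cost makes the input square summable since [Rc] is positive definite, and then
    the state by detectability. The terminal term therefore vanishes in the limit. *)
Lemma cost_cvg u (w : nat -> 'cV[R]_n) x0 :
  l2_bounded (fun t => enorm (w t)) -> cvgn (stage_cost u w x0) ->
  l2_bounded (fun t => enorm (traj A B u w x0 t)) /\
  cost A B Q QT Rc u w x0 = (limn (stage_cost u w x0))%:E.
Proof.
move=> hw cS; pose x t := traj A B u w x0 t; pose S T := stage_cost u w x0 T.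
have Qpos z : 0 <= qform Q z by case: hQ.
have Rpos z : 0 <= qform Rc z by case: (pdmx_psd hRc).
have Sle T : S T <= limn S.
  by apply: nondecreasing_cvgn_le => //; exact: stage_cost_nondecreasing.
have hx : l2_bounded (fun t => enorm (x t)).
  apply: (@detectable_l2_bounded _ _ A Q x (fun t => B *m u t + w t) (limn S)) => //.
  - by move=> t; rewrite addrA.
  - apply: l2_bounded_enormD => //; apply: l2_bounded_mulmx.
    have [k k0 hk] := pd_sqr_le hRc.
    apply: (@l2_bounded_sum _ _ (k * limn S)) => T.
    apply: (@le_trans _ _ (k * S T)); last by rewrite ler_wpM2l.
    rewrite mulr_sumr; apply: ler_sum => t _.
    by rewrite (le_trans (hk _))// ler_wpM2l// lerDr.
  - move=> T; apply: le_trans (Sle T); apply: ler_sum => t _.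
    by rewrite lerDl.
split=> //.
have cc : (fun T => costT A B Q QT Rc u w x0 T) @ \oo --> limn S.
  rewrite -[X in _ --> X]add0r; apply: cvgD; last exact: cS.
  exact: qform_cvg0.
rewrite /cost EFin_lim; last by apply: cvgP cc.
by congr (_%:E); exact: cvg_lim.
Qed.

(** The nonnegative terminal term cannot compensate the divergence of the monotone stage cost. *)
Lemma cost_dvg u (w : nat -> 'cV[R]_n) x0 :
  ~ cvgn (stage_cost u w x0) -> cost A B Q QT Rc u w x0 = +oo%E.
Proof.
move=> dS; rewrite /cost; apply: cvg_lim => //; apply/cvgeryP/cvgryPge => a.
have /cvgryPge/(_ a) :=
  nondecreasing_dvgn_lt (@stage_cost_nondecreasing u w x0) dS.
apply: filterS => T h; apply: (le_trans h).
by rewrite /costT -/(stage_cost u w x0 T) lerDr; case: hQT.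
Qed.

End Cost.

Section ClosedLoop.
Variables (R : realType) (n m : nat) (A : 'M[R]_n) (B : 'M[R]_(n, m)).
Variables (Q : 'M[R]_n) (Rc : 'M[R]_m) (K : 'M[R]_(m, n)).
Let F := A - B *m K.

Lemma fb_trajS (w : nat -> 'cV[R]_n) x0 t :
  fb_traj A B K w x0 t.+1 = F *m fb_traj A B K w x0 t + w t.
Proof. by rewrite /= mulmxN mulmxA -mulmxBl. Qed.

Lemma traj_fb_input (w : nat -> 'cV[R]_n) x0 t :
  traj A B (fb_input A B K w x0) w x0 t = fb_traj A B K w x0 t.
Proof. by elim: t => //= t ->. Qed.

(** The two cross terms are kept apart because [P] is given only by a Lyapunov equation and symmetry
    is not among the assumptions. *)
Definition loop_cross (P : 'M[R]_n) (w x : nat -> 'cV[R]_n) T : R :=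
  \sum_(0 <= t < T) (dot (w t) (P *m w t)
    + dot (w t) (P *m (F *m x t)) + dot (F *m x t) (P *m w t)).

Lemma closed_loop_stage_cost (P : 'M[R]_n) (w : nat -> 'cV[R]_n) x0 T :
  P = F^T *m P *m F + Q + K^T *m Rc *m K ->
  let x := fb_traj A B K w x0 in
  stage_cost A B Q Rc (fb_input A B K w x0) w x0 T + qform P (x T)
  = qform P x0 + loop_cross P w x T.
Proof.
move=> eP x; rewrite /stage_cost /loop_cross; elim: T => [|T IH].
  by rewrite !big_geq// add0r addr0.
rewrite !big_nat_recr//= traj_fb_input -/(x T).
have h1 : qform P (x T) = qform P (F *m x T) + qform Q (x T) + qform Rc (K *m x T).
  by rewrite {1}eP !qformD !qform_conj.
have h2 : qform Rc (fb_input A B K w x0 T) = qform Rc (K *m x T).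
  by rewrite !qformE /fb_input mulmxN dotNl dotNr opprK.
have h3 : qform P (x T.+1) = qform P (F *m x T) + dot (w T) (P *m w T)
    + dot (w T) (P *m (F *m x T)) + dot (F *m x T) (P *m w T).
  by rewrite /x fb_trajS !qformE mulmxDr !dotlin; ring.
rewrite h2 -/(x T.+1) h3; move: IH; lra.
Qed.

Variables (c lam X d : R).
Hypotheses (c1 : 1 < c) (lam0 : 0 <= lam) (lam1 : lam < 1).
Hypothesis hF : forall i : nat, (1 <= i)%N -> specnorm (F ^+ i) <= c * lam ^+ i.
Variables (w w' : nat -> 'cV[R]_n) (x0 : 'cV[R]_n) (T : nat).
Hypotheses (hw : vl2 T w <= 1) (hw' : vl2 T w' <= 1).
Hypotheses (hd : vl2 T (fun t => w t - w' t) <= d) (hx0 : enorm x0 <= X).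

Let e := c * (lam / (1 - lam)).
Let e0 : 0 <= e.
Proof.
by rewrite mulr_ge0 ?divr_ge0 ?subr_ge0 ?(ltW lam1)// ltW// (lt_trans _ c1).
Qed.

(** Each cross term costs [e * (X + 1) * d] when [w] varies against the response and [e * d] when
    the response varies against a disturbance of norm at most 1; together [e * (2 + X) * d]. *)
Lemma closed_loop_diff (P : 'M[R]_n) :
  loop_cross P w (fb_traj A B K w x0) T - loop_cross P w' (fb_traj A B K w' x0) T
  <= specnorm P * (2 * d + 2 * (e * (2 + X) * d)).
Proof.
set x := fb_traj A B K w x0; set x' := fb_traj A B K w' x0.
have hy : vl2 T (fun t => F *m x t) <= e * (X + 1).
  have := forward_response_le c1 lam0 lam1 hF T (fb_trajS w x0).
  by move=> /le_trans; apply; rewrite ler_wpM2l// lerD.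
have hy' : vl2 T (fun t => F *m x' t) <= e * (X + 1).
  have := forward_response_le c1 lam0 lam1 hF T (fb_trajS w' x0).
  by move=> /le_trans; apply; rewrite ler_wpM2l// lerD.
have hdy : vl2 T (fun t => F *m x t - F *m x' t) <= e * d.
  under [X in vl2 T X]eq_fun do rewrite -mulmxBr.
  have zS t : x t.+1 - x' t.+1 = F *m (x t - x' t) + (w t - w' t).
    by rewrite /x /x' !fb_trajS mulmxBr opprD addrACA.
  have := @forward_response_le _ _ _ _ _ c1 lam0 lam1 hF
    (fun t => w t - w' t) (fun t => x t - x' t) T zS.
  move=> /le_trans; apply; rewrite -/e ler_wpM2l//.
  by rewrite /x/x'/= subrr enorm0 add0r.
have h1 := sum_dot_mulmx_diff P hd hd hw hw'.
have h2 := sum_dot_mulmx_diff P hd hdy hy hw'.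
have h3 := sum_dot_mulmx_diff P hdy hd hw hy'.
rewrite /loop_cross -sumrB.
apply: le_trans (_ : _ <= _) _; last first.
  apply: (@le_trans _ _ (specnorm P * (d * 1 + 1 * d)
    + specnorm P * (d * (e * (X + 1)) + 1 * (e * d))
    + specnorm P * (e * d * 1 + e * (X + 1) * d))); last first.
    by rewrite le_eqVlt; apply/orP; left; apply/eqP; ring.
  exact: lerD (lerD h1 h2) h3.
rewrite -!big_split/= le_eqVlt; apply/orP; left; apply/eqP.
by apply: eq_bigr => t _; ring.
Qed.

(** What [lq_sum] leaves, apart from the [P] terms at both ends, once the square is removed and [s]
    vanishes at [T]. *)
Definition offline_value (P H : 'M[R]_n) (s w : nat -> 'cV[R]_n) : R :=
  2 * dot (F^T *m s 0%N) x0
  + \sum_(0 <= t < T) (qform P (w t) + 2 * dot (F^T *m s t.+1) (w t)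
                       - qform H (s t)).

(** The order is [w'] minus [w] because the offline value enters the regret with a minus sign. The
    factor [2 + X] collects [X] from the initial state and 2 from the pairing of costate and
    disturbance; the [H] term is [2 * specnorm H * k ^+ 2 * d]. *)
Lemma offline_value_diff (P H : 'M[R]_n) :
  offline_value P H (costate F P T w') w' - offline_value P H (costate F P T w) w
  <= specnorm P * (2 * d + 2 * (e * (2 + X) * d))
     + 2 * specnorm H * specnorm P ^+ 2 * (c ^+ 2 / (1 - lam) ^+ 2) * d.
Proof.
set s := costate F P T w; set s' := costate F P T w'.
pose k := c * specnorm P / (1 - lam).
have k0 : 0 <= k.
  by rewrite !mulr_ge0 ?specnorm_ge0 ?invr_ge0 ?subr_ge0 ?(ltW lam1)// ltW// (lt_trans _ c1).
have hd' : vl2 T (fun t => w' t - w t) <= d.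
  apply: le_trans hd; apply: l2_le => t _; rewrite enorm_ge0/= -enormN opprB//.
have pe0 : 0 <= specnorm P * e by rewrite mulr_ge0 ?specnorm_ge0.
have hs : vl2 T s <= k.
  have := costate_l2_le c1 lam0 lam1 hF P T w.
  by move=> /le_trans; apply; rewrite -/k ler_piMr.
have hs' : vl2 T s' <= k.
  have := costate_l2_le c1 lam0 lam1 hF P T w'.
  by move=> /le_trans; apply; rewrite -/k ler_piMr.
have hds : vl2 T (fun t => s t - s' t) <= k * d.
  under [X in vl2 T X]eq_fun do rewrite costateB.
  have := costate_l2_le c1 lam0 lam1 hF P T (fun t => w t - w' t).
  by move=> /le_trans; apply; rewrite -/k ler_wpM2l.
have hr' : vl2 T (fun t => F^T *m s' t.+1) <= specnorm P * e.
  have := trmulmx_costate_l2_le c1 lam0 lam1 hF P T w'.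
  by move=> /le_trans; apply; rewrite -/e ler_piMr.
have hr : vl2 T (fun t => F^T *m s t.+1) <= specnorm P * e.
  have := trmulmx_costate_l2_le c1 lam0 lam1 hF P T w.
  by move=> /le_trans; apply; rewrite -/e ler_piMr.
have hdr : vl2 T (fun t => F^T *m s' t.+1 - F^T *m s t.+1) <= specnorm P * e * d.
  under [X in vl2 T X]eq_fun do rewrite -mulmxBr costateB.
  have := trmulmx_costate_l2_le c1 lam0 lam1 hF P T (fun t => w' t - w t).
  by move=> /le_trans; apply; rewrite -/e ler_wpM2l.
have h0 : dot (F^T *m s' 0%N) x0 - dot (F^T *m s 0%N) x0 <= specnorm P * e * d * X.
  rewrite -dotNl -dotDl -mulmxBr costateB (le_trans (dot_le_enorm _ _))//.
  rewrite ler_pM ?enorm_ge0//.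
  have := trmulmx_costate0_le c1 lam0 lam1 hF P T (fun t => w' t - w t).
  by move=> /le_trans; apply; rewrite -/e ler_wpM2l.
have h1 := sum_dot_mulmx_diff P hd' hd' hw' hw.
have h2 := sum_dot_diff hdr hd' hw' hr.
have h3 := sum_dot_mulmx_diff H hds hds hs hs'.
rewrite /offline_value opprD addrACA -mulrBr -sumrB.
have -> : \sum_(0 <= t < T) (qform P (w' t) + 2 * dot (F^T *m s' t.+1) (w' t)
      - qform H (s' t) - (qform P (w t) + 2 * dot (F^T *m s t.+1) (w t) - qform H (s t)))
  = \sum_(0 <= t < T) (dot (w' t) (P *m w' t) - dot (w t) (P *m w t))
  + 2 * \sum_(0 <= t < T) (dot (F^T *m s' t.+1) (w' t) - dot (F^T *m s t.+1) (w t))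
  + \sum_(0 <= t < T) (dot (s t) (H *m s t) - dot (s' t) (H *m s' t)).
  rewrite mulr_sumr -!big_split/=; apply: eq_bigr => t _; rewrite !qformE; ring.
apply: (@le_trans _ _ (2 * (specnorm P * e * d * X)
  + (specnorm P * (d * 1 + 1 * d)
     + 2 * (specnorm P * e * d * 1 + specnorm P * e * d)
     + specnorm H * (k * d * k + k * (k * d))))).
  apply: lerD; first by rewrite ler_pM2l.
  by apply: lerD h3; apply: lerD h1 _; rewrite ler_pM2l.
rewrite le_eqVlt; apply/orP; left; apply/eqP; rewrite /k; field.
by rewrite subr_eq0 gt_eqF.
Qed.

End ClosedLoop.

(** * Regret along the worst case *)

Section CostateTail.
Variables (R : realType) (n : nat) (F : 'M[R]_n) (c lam : R).
Hypotheses (c1 : 1 < c) (lam0 : 0 <= lam) (lam1 : lam < 1).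
Hypothesis hF : forall i : nat, (1 <= i)%N -> specnorm (F ^+ i) <= c * lam ^+ i.

(** Both sequences solve the same backward recursion, so their difference is propagated back from
    time [T], where the truncated one is 0. *)
Lemma costate_tail (P : 'M[R]_n) (w s : nat -> 'cV[R]_n) T t :
  (forall t, s t = P *m w t + F^T *m s t.+1) -> (t <= T)%N ->
  costate F P T w t = s t - (F ^+ (T - t))^T *m s T.
Proof.
move=> hs /subnK <-; move: (T - t)%N => {T} k.
elim: k t => [|k IH] t.
  by rewrite add0n costate_end subnn expr0 trmx1 mul1mx subrr.
rewrite costate_rec ?addSn ?ltnS ?leq_addl// -addnS IH [s t]hs mulmxBr addrA.
by rewrite !addnK addnS -addSn addnK exprSr -mulmxE trmx_mul mulmxA.
Qed.

(** Bounds, uniformly in [T], the total loss caused by replacing the exact costate along the worst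
    case by its truncation. *)
Lemma costate_tail_qform_le (H : 'M[R]_n) (y : 'cV[R]_n) T :
  \sum_(0 <= t < T) qform H ((F ^+ (T - t))^T *m y)
  <= specnorm H * c ^+ 2 / (1 - lam) * enorm y ^+ 2.
Proof.
apply: (@le_trans _ _ (\sum_(0 <= t < T)
    specnorm H * c ^+ 2 * enorm y ^+ 2 * (lam ^+ (T - t)) ^+ 2)).
  apply: ler_sum => t _.
  have [_ h] := pow_mulmx_le c1 hF (T - t) y.
  apply: le_trans (le_trans (ler_norm _) (qform_le_specnorm _ _)) _.
  rewrite -!mulrA ler_wpM2l ?specnorm_ge0//.
  rewrite [leRHS](_ : _ = (c * lam ^+ (T - t) * enorm y) ^+ 2); last by ring.
  by rewrite lerXn2r ?nnegrE ?enorm_ge0// (le_trans _ h) ?enorm_ge0.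
rewrite -mulr_sumr [leRHS](_ : _ = specnorm H * c ^+ 2 * enorm y ^+ 2 * (1 - lam)^-1).
  apply: ler_wpM2l (sum_geometric_sqr_le lam0 lam1 T).
  by apply: mulr_ge0 (sqr_ge0 _); apply: mulr_ge0 (specnorm_ge0 _) (sqr_ge0 _).
by ring.
Qed.

End CostateTail.

Section WorstCase.
Variables (R : realType) (n m : nat) (A : 'M[R]_n) (B : 'M[R]_(n, m)).
Variables (Q : 'M[R]_n) (Rc : 'M[R]_m) (g : R) (M : 'M[R]_n).
Hypotheses (hRc : pdmx Rc) (hM : hinf_riccati A B Q Rc g M).
Let K := hinf_gain A B Rc g M.
Variable x0 : 'cV[R]_n.
Let x := wc_state A B Rc g M x0.
Let w := wc_dist A B Rc g M x0.

Let xSE t : x t.+1 = invmx (hinf_Lambda B Rc g M) *m (A *m x t).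
Proof. by rewrite /x /= mulmxA. Qed.

(** The open-loop disturbance is [game_w] at [A x], so by [game_next] the loop driven by it follows
    exactly [Lambda^-1 A]. *)
Lemma wc_stateS t : x t.+1 = A *m x t + B *m (- (K *m x t)) + w t.
Proof.
have [_ uL _] := hM.
have -> : w t = game_w B Rc g M (A *m x t) by rewrite /w /wc_dist /game_w !mulmxA.
by rewrite -(game_u_hinf_gain A B Rc g M) game_next// xSE.
Qed.

Lemma fb_traj_wc t : fb_traj A B K w x0 t = x t.
Proof. by elim: t => // t IH; rewrite wc_stateS /= IH. Qed.

Lemma wc_costate t : M *m x t = Q *m x t + A^T *m (M *m x t.+1).
Proof.
have [_ _ eM] := hM; rewrite xSE {1}eM mulmxDl.
by rewrite !mulmxA.
Qed.

Lemma wc_input t : Rc *m (- (K *m x t)) = - (B^T *m (M *m x t.+1)).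
Proof.
rewrite mulmxN xSE; congr (- _).
by rewrite /K /hinf_gain -!mulmxA mulKVmx// pdmx_unit.
Qed.

End WorstCase.

Section FiniteHorizon.
Variables (R : realType) (n m : nat) (A : 'M[R]_n) (B : 'M[R]_(n, m)).
Variables (Q : 'M[R]_n) (Rc : 'M[R]_m) (P M Pinf : 'M[R]_n) (g : R).
Hypotheses (hQ : psdmx Q) (hRc : pdmx Rc) (hP : dare_stabilizing A B Q Rc P).
Hypothesis hM : hinf_riccati A B Q Rc g M.
Let Kinf := hinf_gain A B Rc g M.
Let Finf := A - B *m Kinf.
Let K := dare_gain A B Rc P.
Let F := A - B *m K.
Let G := Rc + B^T *m P *m B.
Let H := B *m invmx G *m B^T.
Hypothesis hPinf : Pinf = Finf^T *m Pinf *m Finf + Q + Kinf^T *m Rc *m Kinf.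
Variables (c lam laminf : R).
Hypotheses (c1 : 1 < c) (lam0 : 0 <= lam) (lam1 : lam < 1).
Hypotheses (laminf0 : 0 <= laminf) (laminf1 : laminf < 1).
Hypothesis hF : forall i : nat, (1 <= i)%N -> specnorm (F ^+ i) <= c * lam ^+ i.
Hypothesis hFinf :
  forall i : nat, (1 <= i)%N -> specnorm (Finf ^+ i) <= c * laminf ^+ i.
Variables (x0 : 'cV[R]_n) (w : nat -> 'cV[R]_n) (X d : R).
Let ws := wc_dist A B Rc g M x0.
Hypothesis hx0 : enorm x0 <= X.
Hypothesis hw : forall T, vl2 T w <= 1.
Hypothesis hws : forall T, vl2 T ws <= 1.
Hypothesis hd : forall T, vl2 T (fun t => w t - ws t) <= d.

Let st t := P *m ws t + (M - P) *m wc_state A B Rc g M x0 t.+1.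

Let st_facts t :
  G *m (- (Kinf *m wc_state A B Rc g M x0 t) + K *m wc_state A B Rc g M x0 t)
    + B^T *m st t = 0
  /\ F^T *m st t = (M - P) *m wc_state A B Rc g M x0 t.
Proof.
apply: (worst_case_costate hRc hP (wc_costate hM x0 t)).
- exact: wc_input.
- exact: (wc_stateS hM).
Qed.

Let st_rec t : st t = P *m ws t + F^T *m st t.+1.
Proof. by have [_ ->] := st_facts t.+1. Qed.

Lemma finite_horizon_regret (u : nat -> 'cV[R]_m) T :
  stage_cost A B Q Rc (fb_input A B Kinf w x0) w x0 T
  - stage_cost A B Q Rc u w x0 T
  <= specnorm Pinf * (2 * d + 2 * (c * (laminf / (1 - laminf)) * (2 + X) * d))
   + specnorm P * (2 * d + 2 * (c * (lam / (1 - lam)) * (2 + X) * d))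
   + 2 * specnorm H * specnorm P ^+ 2 * (c ^+ 2 / (1 - lam) ^+ 2) * d
   + (specnorm H * c ^+ 2 / (1 - lam) * enorm (st T) ^+ 2
      + qform P (traj A B u w x0 T) - qform Pinf (fb_traj A B Kinf w x0 T)
      + qform Pinf (wc_state A B Rc g M x0 T) - qform P (wc_state A B Rc g M x0 T)).
Proof.
have i1 := closed_loop_stage_cost w x0 T hPinf.
have i2 := closed_loop_stage_cost ws x0 T hPinf.
have trajws t : traj A B (fb_input A B Kinf ws x0) ws x0 t = wc_state A B Rc g M x0 t.
  by rewrite traj_fb_input (fb_traj_wc hM).
have s1 := lq_sum hQ hRc hP u x0 (fun t (tT : (t < T)%N) => costate_rec F P w tT).
have s2 := lq_sum hQ hRc hP (fb_input A B Kinf ws x0) x0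
  (fun t (tT : (t < T)%N) => costate_rec F P ws tT).
rewrite /= costate_end mulmx0 dot0l mulr0 subr0 -/K -/F -/G -/H in s1.
rewrite /= costate_end mulmx0 dot0l mulr0 subr0 -/K -/F -/G -/H in s2.
have e1 := closed_loop_diff c1 laminf0 laminf1 hFinf (hw T) (hws T) (hd T) hx0 Pinf.
have e2 := offline_value_diff c1 lam0 lam1 hF (hw T) (hws T) (hd T) hx0 P H.
have invG_psd : psdmx (invmx G).
  apply: invmx_psd; first exact: pdmx_psd (dare_weight_pd hQ hRc hP).
  by case: hP.
have q1 : 0 <= \sum_(0 <= t < T) qform (invmx G)
    (G *m (u t + K *m traj A B u w x0 t) + B^T *m costate F P T w t).
  by apply: sumr_ge0 => t _; case: invG_psd.
(* The exact costate [st] annihilates the argument of the square; only its propagated terminal value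
   is left. *)
have q2 : \sum_(0 <= t < T) qform (invmx G)
    (G *m (fb_input A B Kinf ws x0 t
           + K *m traj A B (fb_input A B Kinf ws x0) ws x0 t)
     + B^T *m costate F P T ws t)
    <= specnorm H * c ^+ 2 / (1 - lam) * enorm (st T) ^+ 2.
  apply: le_trans (costate_tail_qform_le c1 lam0 lam1 hF H (st T) T).
  rewrite le_eqVlt; apply/orP; left; apply/eqP; apply: eq_big_nat => t /andP[_ tT].
  rewrite (costate_tail st_rec (ltnW tT)) trajws /fb_input (fb_traj_wc hM).
  rewrite mulmxBr addrA; have [-> _] := st_facts t.
  rewrite sub0r [LHS]qformE mulmxN dotNl dotNr opprK -qformE.
  by rewrite -[LHS]qform_conj trmxK.
rewrite /= (fb_traj_wc hM) in i2; rewrite /= in i1.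
rewrite trajws -/(stage_cost A B Q Rc _ _ _ _) in s2.
rewrite -/(stage_cost A B Q Rc _ _ _ _) in s1.
(* The identities [i2] and [s2] express the same stage cost, that of the H-infinity input along the
   worst case. Hence [i1 - s1] minus [i2 - s2] is the regret at [w] written through the two
   variations, the squares and the terminal terms. *)
move: q1 q2 e2 s1 s2; rewrite /offline_value -/F.
move: (\sum_(0 <= t < T) qform (invmx G) _) => sq1.
move: (\sum_(0 <= t < T) qform (invmx G) _) => sq2.
move: i1 i2 e1; rewrite -/ws; lra.
Qed.

End FiniteHorizon.

(** * Constants and passage to the infinite horizon *)

Lemma ratio_mono (R : realType) (a b : R) : a <= b -> b < 1 -> a / (1 - a) <= b / (1 - b).
Proof.
move=> ab b1; have a1 := le_lt_trans ab b1.
rewrite ler_pdivrMr ?subr_gt0// mulrAC ler_pdivlMr ?subr_gt0//; lra.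
Qed.

Lemma midpoint1_bounds (R : realType) (r : R) : 0 <= r < 1 -> 0 <= (1 + r) / 2 < 1.
Proof. lra. Qed.

Lemma regret_constants_le (R : realType) (pinf p pbar h c X lam laminf lambar d : R) :
  0 <= pinf <= pbar -> 0 <= p <= pbar -> 0 <= h -> 0 <= c -> 0 <= X -> 0 <= d ->
  0 <= lam <= lambar -> 0 <= laminf <= lambar -> lambar < 1 ->
  pinf * (2 * d + 2 * (c * (laminf / (1 - laminf)) * (2 + X) * d))
  + p * (2 * d + 2 * (c * (lam / (1 - lam)) * (2 + X) * d))
  + 2 * h * p ^+ 2 * (c ^+ 2 / (1 - lam) ^+ 2) * d
  <= (4 * pbar + 4 * c * pbar * (2 + X) * (lambar / (1 - lambar))
      + 2 * h * p ^+ 2 * (c ^+ 2 / (1 - lam) ^+ 2)) * d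
     + (2 * pbar + h * p ^+ 2 * (c ^+ 2 / (1 - lam) ^+ 2)) * d ^+ 2.
Proof.
move=> b1 b2 h0 c0 X0 d0 b4 b3 lb1.
have bound q l : 0 <= q <= pbar -> 0 <= l <= lambar ->
    q * (2 * d + 2 * (c * (l / (1 - l)) * (2 + X) * d))
    <= pbar * (2 * d + 2 * (c * (lambar / (1 - lambar)) * (2 + X) * d)).
  move=> /andP[q0 qp] /andP[l0' ll].
  have r0 : 0 <= l / (1 - l) by rewrite divr_ge0// subr_ge0 ltW// (le_lt_trans ll).
  have X2 : 0 <= 2 + X by rewrite addr_ge0.
  apply: ler_pM => //.
    have e0 : 0 <= c * (l / (1 - l)) * (2 + X) * d.
      by apply: mulr_ge0 => //; apply: mulr_ge0 => //; exact: mulr_ge0.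
    by apply: addr_ge0; exact: mulr_ge0.
  rewrite lerD2l ler_pM2l// ler_wpM2r// ler_wpM2r// ler_wpM2l//.
  exact: ratio_mono.
have h1 := bound _ _ b1 b3; have h2 := bound _ _ b2 b4.
have k2 : 0 <= (2 * pbar + h * p ^+ 2 * (c ^+ 2 / (1 - lam) ^+ 2)) * d ^+ 2.
  have pb : 0 <= pbar by case/andP: b2; exact: le_trans.
  apply: mulr_ge0 (sqr_ge0 _); apply: addr_ge0; first exact: mulr_ge0.
  exact: mulr_ge0 (mulr_ge0 h0 (sqr_ge0 _)) (divr_ge0 (sqr_ge0 _) (sqr_ge0 _)).
move: h1 h2 k2; lra.
Qed.

Theorem mainTheorem1 (R : realType) (n m : nat)
  (A : 'M[R]_n) (B : 'M[R]_(n, m)) (Q QT : 'M[R]_n) (Rc : 'M[R]_m)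
  (hQ : psdmx Q) (hQT : psdmx QT) (hRc : pdmx Rc)
  (hdet : detectable A Q) (hstab : stabilizable A B)
  (X : R) (hX : 0 < X)
  (x0 : 'cV[R]_n) (hx0s : admissible_init A B Q Rc x0) (hx0 : enorm x0 <= X)
  (gbar : R) (hgbar : (gamma_low A B Q Rc < gbar%:E)%E)
  (M : 'M[R]_n) (hM : hinf_minimal A B Q Rc gbar M)
  (hwstar : seqnorm (wc_dist A B Rc gbar M x0) = 1%E)
  (P : 'M[R]_n) (hP : dare_stabilizing A B Q Rc P)
  (Pinf : 'M[R]_n) (c : R)
  (w : nat -> 'cV[R]_n) (hw : (seqnorm w <= 1)%E)
  (ustar : nat -> 'cV[R]_m)
  (hustar : offline_optimal A B Q QT Rc w x0 ustar) :
  let Kinf := hinf_gain A B Rc gbar M in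
  let Finf := A - B *m Kinf in
  let uinf := fb_input A B Kinf w x0 in
  let F := A - B *m dare_gain A B Rc P in
  let H := B *m invmx (Rc + B^T *m P *m B) *m B^T in
  let lam := (1 + spectral_radius F) / 2 in
  let laminf := (1 + spectral_radius Finf) / 2 in
  let lambar := Num.max lam laminf in
  let normPbar := Num.max (specnorm Pinf) (specnorm P) in
  let dw := fun t => w t - wc_dist A B Rc gbar M x0 t in
  let k2 := 2 * normPbar
            + specnorm H * specnorm P ^+ 2 * (c ^+ 2 / (1 - lam) ^+ 2) in
  let k1 := 4 * normPbar
            + 4 * c * normPbar * (2 + X) * (lambar / (1 - lambar))
            + 2 * specnorm H * specnorm P ^+ 2
                * (c ^+ 2 / (1 - lam) ^+ 2) in
  Pinf = Finf^T *m Pinf *m Finf + Q + Kinf^T *m Rc *m Kinf ->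
  1 < c ->
  (forall i : nat, (1 <= i)%N -> specnorm (F ^+ i) <= c * lam ^+ i) ->
  (forall i : nat, (1 <= i)%N -> specnorm (Finf ^+ i) <= c * laminf ^+ i) ->
  [/\ cost A B Q QT Rc uinf w x0 \is a fin_num,
      cost A B Q QT Rc ustar w x0 \is a fin_num
    & (regret A B Q QT Rc uinf ustar w x0
       <= k1%:E * seqnorm dw + k2%:E * seqnorm dw ^+ 2)%E].
Proof.
move=> Kinf Finf uinf F H lam laminf lambar normPbar dw k2 k1 hPinf c1 hF hFinf.
have [g0 hgM] := hinf_minimal_feasible hQ hRc hgbar hM.
have [rM _] := hM.
(* Stability of the H-infinity loop has to be derived: it gives [laminf < 1], on which the geometric
   bounds rest. *)
have Finf1 : spectral_radius Finf < 1.
  exact: hinf_spectral_radius_lt1 hQ hRc g0 rM hgM hdet.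
have /andP[laminf0 laminf1] : 0 <= laminf < 1.
  by apply: midpoint1_bounds; rewrite spectral_radius_ge0 Finf1.
have /andP[lam0 lam1] : 0 <= lam < 1.
  have [_ _ _ F1] := hP.
  by apply: midpoint1_bounds; rewrite spectral_radius_ge0 F1.
(* Keeps unification from unfolding the two spectral radii against each other. *)
clearbody lam laminf.
have lambar1 : lambar < 1 by rewrite gt_max lam1 laminf1.
set ws := wc_dist A B Rc gbar M x0 in hwstar dw *.
have hw1 T : vl2 T w <= 1 by exact: vl2_le_seqnorm.
have hws1 T : vl2 T ws <= 1 by apply: vl2_le_seqnorm; rewrite hwstar.
have [d ed [d0 hd]] : exists2 d, seqnorm dw = d%:E & 0 <= d /\ forall T, vl2 T dw <= d.
  apply: (@seqnorm_fin _ _ _ (1 + 1)) => T.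
  apply: le_trans (vl2D T w (fun t => - ws t)) _; apply: lerD; first exact: hw1.
  by rewrite /vl2; under [X in l2 T X]eq_fun do rewrite enormN; exact: hws1.
have wl2 := vl2_l2_bounded hw1; have wsl2 := vl2_l2_bounded hws1.
pose x := fb_traj A B Kinf w x0.
have xl2 : l2_bounded (fun t => enorm (x t)).
  by apply: (@spectral_radius_lt1_l2 _ _ Finf x w) => // t; rewrite /x fb_trajS.
pose z := wc_state A B Rc gbar M x0.
(* The worst-case state is the H-infinity loop driven by [ws], so the same stability argument
   applies. *)
have zl2 : l2_bounded (fun t => enorm (z t)).
  apply: (@spectral_radius_lt1_l2 _ _ Finf z ws) => // t.
  by rewrite /z -!(fb_traj_wc rM) fb_trajS.
have cinf : cvgn (stage_cost A B Q Rc uinf w x0).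
  have [C hC] := xl2.
  apply: nondecreasing_is_cvgn; first exact: stage_cost_nondecreasing.
  exists ((specnorm Q + specnorm Rc * specnorm Kinf ^+ 2) * C ^+ 2) => _ [T _ <-].
  have CC : l2 T (fun t => enorm (x t)) ^+ 2 <= C ^+ 2.
    by rewrite lerXn2r ?nnegrE ?l2_ge0 ?(le_trans _ (hC T))// ?l2_ge0 ?hC.
  have s0 : 0 <= specnorm Q + specnorm Rc * specnorm Kinf ^+ 2.
    by rewrite addr_ge0 ?mulr_ge0 ?sqr_ge0 ?specnorm_ge0.
  apply: le_trans (ler_wpM2l s0 CC).
  rewrite l2_sqr mulr_sumr; apply: ler_sum => t _.
  rewrite traj_fb_input -/(x t) mulrDl; apply: lerD.
    exact: le_trans (ler_norm _) (qform_le_specnorm _ _).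
  apply: le_trans (le_trans (ler_norm _) (qform_le_specnorm _ _)) _.
  rewrite -mulrA ler_wpM2l ?specnorm_ge0// enormN -exprMn.
  by rewrite lerXn2r ?nnegrE ?enorm_ge0 ?mulr_ge0 ?specnorm_ge0 ?enorm_ge0 ?specnorm_mulmx.
have [_ costinf] := cost_cvg QT hQ hRc hdet wl2 cinf.
(* A divergent stage cost would make the cost of [ustar] infinite, against optimality compared with
   [uinf], whose cost is finite. *)
have cstar : cvgn (stage_cost A B Q Rc ustar w x0).
  apply: contrapT => /(cost_dvg hQ hQT hRc) coo.
  by have := hustar uinf; rewrite coo costinf.
have [xsl2 coststar] := cost_cvg QT hQ hRc hdet wl2 cstar.
rewrite /regret costinf coststar; split=> //.
rewrite ed -EFinB -EFinM -EFin_expe -EFinM -EFinD lee_fin.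
have c0 : 0 <= c by rewrite ltW// (lt_trans _ c1).
apply: le_trans (@regret_constants_le _ (specnorm Pinf) (specnorm P) _ _ _ _ _ laminf
  _ _ _ _ (specnorm_ge0 H) c0 (ltW hX) d0 _ _ _); last first.
- exact: lambar1.
- by rewrite laminf0 le_max lexx orbT.
- by rewrite lam0 le_max lexx.
- by rewrite specnorm_ge0 le_max lexx orbT.
- by rewrite specnorm_ge0 le_max lexx.
pose st t := P *m ws t + (M - P) *m z t.+1.
have stl2 : l2_bounded (fun t => enorm (st t)).
  apply: l2_bounded_enormD; apply: l2_bounded_mulmx => //.
  exact: l2_bounded_mulmx.
have st0 := l2_bounded_cvg0 stl2.
set kd := (X in _ <= X).
pose err T := specnorm H * c ^+ 2 / (1 - lam) * enorm (st T) ^+ 2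
      + qform P (traj A B ustar w x0 T) - qform Pinf (x T)
      + qform Pinf (z T) - qform P (z T).
have err0 : err @ \oo --> (0 : R).
  have h : err @ \oo --> specnorm H * c ^+ 2 / (1 - lam) * (0 * 0) + 0 - 0 + 0 - 0.
    apply: cvgB; last exact: qform_cvg0.
    apply: cvgD; last exact: qform_cvg0.
    apply: cvgB; last exact: qform_cvg0.
    apply: cvgD; last exact: qform_cvg0.
    apply: cvgM; first exact: cvg_cst.
    exact: cvgM.
  by rewrite !(mulr0, addr0, subr0) in h.
rewrite -[leRHS]addr0.
(* Both infinite-horizon costs are limits of stage costs alone, so the finite-horizon bound passes
   to the limit with [err] tending to 0. *)
apply: (ler_cvg_to (cvgB cinf cstar) (cvgD (cvg_cst kd) err0)).
apply: nearW => T.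
exact: (finite_horizon_regret hQ hRc hP rM hPinf c1 lam0 lam1 laminf0 laminf1 hF hFinf
  hx0 hw1 hws1 hd).
Qed.
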